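(* For each (locally compact, nondiscrete) local field $\mathrm{k}$ and each integer $n\ge 2$, the topological group $\mathrm{Bir}_{\mathbb{P}^n}(\mathrm{k})$ is topologically simple when endowed with the Euclidean topology, i.e. it does not contain any non-trivial closed normal strict subgroup: if $N\subseteq \mathrm{Bir}_{\mathbb{P}^n}(\mathrm{k})$ is a normal subgroup that is closed in the Euclidean topology, then $N=\{\mathrm{id}\}$ or $N=\mathrm{Bir}_{\mathbb{P}^n}(\mathrm{k})$.
   Context: For a field $\mathrm{k}$, $\mathrm{Bir}_{\mathbb{P}^n}(\mathrm{k})$ is the group of birational transformations of $\mathbb{P}^n$ defined over $\mathrm{k}$. Local fields are assumed locally compact and nondiscrete (for example $\mathbb{R}$, $\mathbb{C}$, $\mathbb{F}_q((t))$, or a finite extension of $\mathbb{Q}_p$). Euclidean topology. Let $\mathrm{k}$ be such a local field. For $d\ge 1$, let $W_d(\mathrm{k})$ be the projective space of classes $[h_0:\dots:h_n]$, up to scaling by $\mathrm{k}^*$, of non-zero $(n+1)$-tuples of homogeneous polynomials $h_i\in \mathrm{k}[x_0,\dots,x_n]$ of degree $d$. Let $H_d(\mathrm{k})\subseteq W_d(\mathrm{k})$ be the subset of those $h=[h_0:\dots:h_n]$ such that the rational map $\psi_h\colon[x_0:\dots:x_n]\dashrightarrow[h_0(x_0,\dots,x_n):\dots:h_n(x_0,\dots,x_n)]$ of $\mathbb{P}^n$ is birational, and let $\pi_d\colon H_d(\mathrm{k})\to \mathrm{Bir}_{\mathbb{P}^n}(\mathrm{k})$, $h\mapsto \psi_h$.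 Its image is $\{f\in \mathrm{Bir}_{\mathbb{P}^n}(\mathrm{k})\mid \deg(f)\le d\}$. Put the classical Euclidean topology on the projective space $W_d(\mathrm{k})$, the induced topology on $H_d(\mathrm{k})$, and the quotient topology induced by $\pi_d$ on $\{f\mid \deg(f)\le d\}$. The Euclidean topology on $\mathrm{Bir}_{\mathbb{P}^n}(\mathrm{k})$ is the inductive limit topology induced by the inclusions $\{f\mid\deg(f)\le d\}\to\{f\mid\deg(f)\le d+1\}$. It makes $\mathrm{Bir}_{\mathbb{P}^n}(\mathrm{k})$ a Hausdorff topological group. *)

(* Defs.v *)
From HB Require Import structures.
From mathcomp Require Import all_boot all_order all_algebra generic_quotient.
From mathcomp Require Import mpoly.
From mathcomp Require Import boolp classical_sets functions.
From mathcomp Require Import topology_structure compact separation_axioms.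
From mathcomp Require Import product_topology initial_topology function_spaces.
From mathcomp Require Import quotient_topology subtype_topology tvs.

Set Implicit Arguments.
Unset Strict Implicit.
Unset Printing Implicit Defensive.

Import GRing.Theory.
Local Open Scope classical_set_scope.
Local Open Scope ring_scope.
Local Open Scope quotient_scope.

(* A local field is a non-discrete locally compact Hausdorff topological field;
   the continuity of x + y and - x comes from TopologicalZmodule. *)
HB.mixin Record TopologicalZmodule_isLocalField K
    & GRing.Field K & TopologicalZmodule K := {
  local_mul_continuous : continuous (fun x : K * K => x.1 * x.2) ;
  local_inv_continuous : forall x : K, x != 0 -> {for x, continuous (@GRing.inv K)} ;
  local_hausdorff : hausdorff_space K ;
  local_locally_compact : locally_compact [set: K] ;
  local_nondiscrete : ~ (forall A : set K, open A)
}.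

#[short(type="localFieldType")]
HB.structure Definition LocalField :=
  {K of GRing.Field K & TopologicalZmodule K & TopologicalZmodule_isLocalField K}.

Section Homogeneous.
Variables (K : fieldType) (n : nat).

Record htuple (d : nat) := HTuple {
  hval :> n.+1.-tuple {mpoly K[n.+1]} ;
  _ : all (fun p => p \is d.-homog) hval && has (fun p => p != 0) hval
}.
HB.instance Definition _ d := [isSub for @hval d].
HB.instance Definition _ d := [Choice of htuple d by <:].

Definition hprop d (g h : htuple d) : bool :=
  `[< exists2 c : K, c != 0 & forall i, tnth g i = c *: tnth h i >].

Lemma hprop_equiv d : equiv_class_of (@hprop d).
Proof.
split.
- by move=> g; apply/asboolP; exists 1 => [|i]; rewrite ?oner_eq0 ?scale1r.
- have hpropC g h : @hprop d g h -> hprop h g.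
    move=> /asboolP[c c0 gh]; apply/asboolP; exists c^-1; first by rewrite invr_eq0.
    by move=> i; rewrite gh scalerA mulVf // scale1r.
  by move=> g h; apply/idP/idP; exact: hpropC.
- move=> h g k /asboolP[a a0 gh] /asboolP[b b0 hk]; apply/asboolP.
  by exists (a * b) => [|i]; rewrite ?mulf_neq0 // gh hk scalerA.
Qed.

Canonical hprop_equivRel d := EquivRelPack (@hprop_equiv d).

(* The projective space W_d of non-zero homogeneous tuples of degree d, up to
   scaling by K^*. *)
Definition projW (d : nat) := {eq_quot (hprop_equivRel d)}.

(* A rational self-map of P^n is given by a non-zero tuple of homogeneous
   polynomials of any common degree; two tuples give the same map iff their
   2 x 2 minors vanish. *)
Definition rrep := {d : nat & htuple d}.
Definition rtuple (F : rrep) : n.+1.-tuple {mpoly K[n.+1]} := hval (tagged F).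

Definition req (F G : rrep) : bool :=
  [forall i, forall j, tnth (rtuple F) i * tnth (rtuple G) j
                    == tnth (rtuple F) j * tnth (rtuple G) i].

Lemma reqP F G : reflect (forall i j, tnth (rtuple F) i * tnth (rtuple G) j
                    = tnth (rtuple F) j * tnth (rtuple G) i) (req F G).
Proof.
apply: (iffP forallP) => [H i j|H i]; first by have /forallP/(_ j)/eqP := H i.
by apply/forallP => j; apply/eqP.
Qed.

Lemma rtuple_neq0 F : exists i, tnth (rtuple F) i != 0.
Proof. by case: F => d [h H]; have /andP[_ /hasP[p /tnthP[i ->] ?]] := H; exists i. Qed.

Lemma rtuple_homog F i : tnth (rtuple F) i \is (tag F).-homog.
Proof. by case: F => d [h H]; have /andP[/all_tnthP/(_ i) + _] := H. Qed.

Lemma reqC F G : req F G = req G F.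
Proof.
by apply/reqP/reqP => H i j; rewrite mulrC -H mulrC.
Qed.

Lemma req_equiv : equiv_class_of req.
Proof.
split.
- by move=> F; apply/reqP => i j; rewrite mulrC.
- exact: reqC.
- move=> G F H /reqP FG /reqP GH; apply/reqP => i k.
  have [j Gj] := rtuple_neq0 G; apply: (mulIf Gj).
  rewrite mulrAC FG -mulrA GH mulrA FG.
  by rewrite mulrAC.
Qed.

Canonical req_equivRel := EquivRelPack req_equiv.

Definition ratmap := {eq_quot req_equivRel}.

(* psi_h, for h in W_d; see psiE for the independence of the representative. *)
Definition psi d (h : projW d) : ratmap := \pi_ratmap (Tagged htuple (repr h) : rrep).

Lemma psiE d (h : htuple d) :
  psi (\pi_(projW d) h) = \pi_ratmap (Tagged htuple h : rrep).
Proof.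
rewrite /psi; case: piP => g /eqmodP/asboolP[c c0 hg].
by apply/eqmodP/reqP => i j; rewrite /rtuple /= !hg -!scalerAr mulrC.
Qed.

Definition tcomp (u v : n.+1.-tuple {mpoly K[n.+1]}) : n.+1.-tuple {mpoly K[n.+1]} :=
  [tuple tnth u i \mPo v | i < n.+1].

(* e is the composite f o g : the substitution of some representative of g into
   some representative of f is not identically zero and represents e. *)
Definition is_comp (f g e : ratmap) : Prop :=
  exists F G E : rrep, [/\ \pi_ratmap F = f, \pi_ratmap G = g, \pi_ratmap E = e &
    rtuple E = tcomp (rtuple F) (rtuple G)].

Lemma htuple_id_subproof :
  let u := [tuple 'X_i | i < n.+1] : n.+1.-tuple {mpoly K[n.+1]} in
  all (fun p => p \is 1.-homog) u && has (fun p => p != 0) u.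
Proof.
apply/andP; split.
  by apply/all_tnthP => i; rewrite tnth_mktuple dhomogX; apply/eqP; exact: mdeg1.
apply/hasP; exists 'X_ord0; last first.
  by rewrite -msupp_eq0 msuppX.
by apply/tnthP; exists ord0; rewrite tnth_mktuple.
Qed.

Definition rrep_id : rrep := Tagged htuple (HTuple htuple_id_subproof).
Definition ratmap_id : ratmap := \pi_ratmap rrep_id.

Definition birational (f : ratmap) : Prop :=
  exists g, is_comp g f ratmap_id /\ is_comp f g ratmap_id.

Record bir := Bir { bir_val :> ratmap; _ : `[< birational bir_val >] }.
HB.instance Definition _ := [isSub for bir_val].
HB.instance Definition _ := [Choice of bir by <:].

Definition ratcomp (f g : ratmap) : ratmap := xget ratmap_id [set e | is_comp f g e].
Definition ratinv (f : ratmap) : ratmap :=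
  xget ratmap_id [set g | is_comp g f ratmap_id /\ is_comp f g ratmap_id].

Lemma comp_homog d (p c : {mpoly K[n.+1]}) (u v : n.+1.-tuple {mpoly K[n.+1]}) :
  p \is d.-homog -> (forall i, tnth u i = c * tnth v i) ->
  p \mPo u = c ^+ d * (p \mPo v).
Proof.
move=> /dhomogP hp uv; rewrite !comp_mpolyE mulr_sumr big_seq [RHS]big_seq.
apply: eq_bigr => m mp; rewrite -scalerAr; congr (_ *: _).
rewrite -(hp m mp) /= mdegE -prodrXr -big_split /=.
by apply: eq_bigr => i _; rewrite uv exprMn.
Qed.

Lemma comp_comp (p : {mpoly K[n.+1]}) (u v : n.+1.-tuple {mpoly K[n.+1]}) :
  (p \mPo u) \mPo v = p \mPo tcomp u v.
Proof.
rewrite (comp_mpolyE p u) (comp_mpolyE p) raddf_sum /=; apply: eq_bigr => m _.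
rewrite comp_mpolyZ rmorph_prod /=; congr (_ *: _); apply: eq_bigr => i _.
by rewrite rmorphXn /= tnth_mktuple.
Qed.

Lemma tcompA u v w : tcomp (tcomp u v) w = tcomp u (tcomp v w).
Proof. by apply: eq_from_tnth => i; rewrite !tnth_mktuple comp_comp. Qed.

Lemma dhomog_comp d e (p : {mpoly K[n.+1]}) (u : n.+1.-tuple {mpoly K[n.+1]}) :
  p \is e.-homog -> (forall i, tnth u i \is d.-homog) ->
  p \mPo u \is (d * e).-homog.
Proof.
move=> /dhomogP hp hu; rewrite comp_mpolyE big_seq; apply: rpred_sum => m mp.
apply: dhomogZ; rewrite -(hp m mp) /= mdegE big_distrr /=.
elim/big_rec2: _ => [|i a b _ ih]; first exact: dhomog1.
by apply: dhomogM => //; apply: dhomogMn.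
Qed.

Lemma comp_eq0 (F G : rrep) d (p : {mpoly K[n.+1]}) : req F G -> p \is d.-homog ->
  p \mPo rtuple F = 0 -> p \mPo rtuple G = 0.
Proof.
move=> /reqP FG hp pF; have [j Fj] := rtuple_neq0 F.
have Hu i : tnth [tuple tnth (rtuple F) j * tnth (rtuple G) i | i < n.+1] i
    = tnth (rtuple F) j * tnth (rtuple G) i by rewrite tnth_mktuple.
have := comp_homog hp Hu.
rewrite (@comp_homog _ _ (tnth (rtuple G) j) _ (rtuple F) hp) => [|i].
  by rewrite pF mulr0 => /esym/eqP; rewrite mulf_eq0 expf_eq0 (negPf Fj) andbF => /eqP.
by rewrite tnth_mktuple FG mulrC.
Qed.

Definition dom (F : rrep) := forall d p, p \is d.-homog -> p != 0 -> p \mPo rtuple F != 0.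
Definition dominant f := exists2 F : rrep, \pi_ratmap F = f & dom F.

Lemma dominantP F : dominant (\pi_ratmap F) -> dom F.
Proof.
move=> [G /eqmodP GF dG] d p hp p0; apply: contra (dG d p hp p0) => /eqP pF.
by apply/eqP; apply: comp_eq0 hp pF; rewrite reqC.
Qed.

Lemma rcomp_ex F G : dom G -> exists E, rtuple E = tcomp (rtuple F) (rtuple G).
Proof.
move=> dG; pose u := tcomp (rtuple F) (rtuple G).
have Hu : all (fun p => p \is (tag G * tag F)%N.-homog) u && has (fun p => p != 0) u.
  apply/andP; split.
    apply/all_tnthP => i; rewrite tnth_mktuple.
    by apply: dhomog_comp => [|j]; exact: rtuple_homog.
  have [i Fi] := rtuple_neq0 F; apply/hasP; exists (tnth u i); first exact: mem_tnth.
  by rewrite tnth_mktuple (dG (tag F)) // rtuple_homog.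
by exists (Tagged htuple (HTuple Hu)).
Qed.

Lemma req_tcomp F F' G G' E E' : req F F' -> req G G' ->
  rtuple E = tcomp (rtuple F) (rtuple G) ->
  rtuple E' = tcomp (rtuple F') (rtuple G') -> req E E'.
Proof.
move=> /reqP FF' /reqP GG' hE hE'.
have [j Gj] := rtuple_neq0 G.
have [E'' hE''] : exists E'', rtuple E'' = tcomp (rtuple F') (rtuple G).
  pose u := tcomp (rtuple F') (rtuple G).
  have Hu' : all (fun p => p \is (tag G * tag F')%N.-homog) u && has (fun p => p != 0) u.
    apply/andP; split.
      apply/all_tnthP => i; rewrite tnth_mktuple.
      by apply: dhomog_comp => [|k]; exact: rtuple_homog.
    have [i E'i] := rtuple_neq0 E'; apply/hasP; exists (tnth u i); first exact: mem_tnth.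
    apply: contra E'i => /eqP ui; apply/eqP; rewrite hE' tnth_mktuple.
    apply: (@comp_eq0 G G' (tag F')); first exact/reqP.
      exact: rtuple_homog.
    by move: ui; rewrite tnth_mktuple.
  by exists (Tagged htuple (HTuple Hu')).
have EE'' : req E E''.
  apply/reqP => a b; rewrite hE hE'' !tnth_mktuple -!rmorphM /=.
  by rewrite FF'.
have E''E' : req E'' E'.
  apply/reqP => a b; rewrite hE' hE'' !tnth_mktuple.
  pose u := [tuple tnth (rtuple G) j * tnth (rtuple G') i | i < n.+1].
  have Hu i : tnth u i = tnth (rtuple G) j * tnth (rtuple G') i by rewrite tnth_mktuple.
  have Hu' i : tnth u i = tnth (rtuple G') j * tnth (rtuple G) i.
    by rewrite tnth_mktuple GG' mulrC.
  have Gj0 : tnth (rtuple G) j ^+ tag F' != 0 by rewrite expf_neq0.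
  apply: (mulIf Gj0).
  have HF i := comp_homog (rtuple_homog F' i) Hu.
  have HF' i := comp_homog (rtuple_homog F' i) Hu'.
  have {}HF i := etrans (esym (HF i)) (HF' i).
  rewrite -mulrA [_ * _ ^+ _]mulrC HF -[RHS]mulrA [X in _ = _ * X]mulrC HF.
  by rewrite mulrCA [RHS]mulrCA [X in _ * X = _]mulrC.
have [_ _ tr] := req_equiv; exact: tr EE'' E''E'.
Qed.

Lemma is_comp_fun f g e e' : is_comp f g e -> is_comp f g e' -> e = e'.
Proof.
move=> [F [G [E [<- <- <- hE]]]] [F' [G' [E' [/esym/eqmodP FF' /esym/eqmodP GG' <- hE']]]].
by apply/eqmodP; exact: req_tcomp hE hE'.
Qed.

Lemma ratcompE f g e : is_comp f g e -> ratcomp f g = e.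
Proof.
move=> H; apply: (@is_comp_fun f g) (H).
by rewrite /ratcomp; apply: (@xgetPex _ _ [set e | is_comp f g e]); exists e.
Qed.

Lemma is_comp_ratcomp f g : dominant g -> is_comp f g (ratcomp f g).
Proof.
elim/quotW: f => F; elim/quotW: g => G /dominantP dG.
have [E hE] := rcomp_ex F dG.
have H : is_comp (\pi_ratmap F) (\pi_ratmap G) (\pi_ratmap E) by exists F, G, E.
by rewrite (ratcompE H).
Qed.

Lemma dominant_comp f g : dominant f -> dominant g -> dominant (ratcomp f g).
Proof.
move=> df dg; have [F [G [E [hF hG <- hE]]]] := is_comp_ratcomp f dg.
rewrite -hF in df; rewrite -hG in dg; exists E => // d p hp p0.
rewrite hE -comp_comp (dominantP dg (d := tag F * d)) //.
  by apply: dhomog_comp => // i; exact: rtuple_homog.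
exact: (dominantP df hp p0).
Qed.

Lemma ratcompA f g h : dominant f -> dominant g -> dominant h ->
  ratcomp f (ratcomp g h) = ratcomp (ratcomp f g) h.
Proof.
elim/quotW: f => F; elim/quotW: g => G; elim/quotW: h => H dF dG dH.
have [E1 hE1] := rcomp_ex G (dominantP dH).
have [E3 hE3] := rcomp_ex F (dominantP dG).
have GH : ratcomp (\pi_ratmap G) (\pi_ratmap H) = \pi_ratmap E1 by apply: ratcompE; exists G, H, E1.
have FG : ratcomp (\pi_ratmap F) (\pi_ratmap G) = \pi_ratmap E3 by apply: ratcompE; exists F, G, E3.
have dE1 : dominant (\pi_ratmap E1) by rewrite -GH; apply: dominant_comp.
have [E2 hE2] := rcomp_ex F (dominantP dE1).
rewrite GH FG (ratcompE (e := \pi_ratmap E2)); last by exists F, E1, E2.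
symmetry; apply: ratcompE; exists E3, H, E2; split => //.
by rewrite hE2 hE1 hE3 tcompA.
Qed.

Lemma is_comp1f f : is_comp ratmap_id f f.
Proof.
elim/quotW: f => F; exists rrep_id, F, F; split => //.
apply: eq_from_tnth => i; rewrite !tnth_mktuple /=.
by rewrite comp_mpolyXU (tnth_nth 0).
Qed.

Lemma is_compf1 f : is_comp f ratmap_id f.
Proof.
elim/quotW: f => F; exists F, rrep_id, F; split => //.
by apply: eq_from_tnth => i; rewrite !tnth_mktuple /= comp_mpoly_id.
Qed.

Lemma dominant_id : dominant ratmap_id.
Proof. by exists rrep_id => // d p hp p0; rewrite comp_mpoly_id. Qed.

Lemma is_comp_id_dominant f g : is_comp f g ratmap_id -> dominant f.
Proof.
move=> [F [G [E [hF hG /eqmodP/reqP EX hE]]]]; exists F => // d p hp.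
apply: contra => /eqP pF; have [j Ej] := rtuple_neq0 E.
pose u := [tuple tnth (rtuple E) j * 'X_i | i < n.+1].
have pE : p \mPo rtuple E = 0 by rewrite hE -comp_comp pF comp_mpoly0.
have Hu i : tnth u i = tnth (rtuple E) j * tnth (rtuple rrep_id) i.
  by rewrite !tnth_mktuple.
have Hu' i : tnth u i = tnth (rtuple rrep_id) j * tnth (rtuple E) i.
  by rewrite Hu EX mulrC.
have := comp_homog hp Hu; rewrite (comp_homog hp Hu') pE mulr0 comp_mpoly_id.
by move/esym/eqP; rewrite mulf_eq0 expf_eq0 (negPf Ej) andbF.
Qed.

Lemma birational_dominant f : birational f -> dominant f.
Proof. by move=> [g [_ /is_comp_id_dominant]]. Qed.

Lemma birationalP f g : dominant f -> dominant g ->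
  ratcomp g f = ratmap_id -> ratcomp f g = ratmap_id -> birational f.
Proof.
move=> df dg gf fg; exists g; split.
  by rewrite -gf; exact: is_comp_ratcomp.
by rewrite -fg; exact: is_comp_ratcomp.
Qed.

Lemma ratinvP f : birational f -> [/\ birational (ratinv f),
  ratcomp (ratinv f) f = ratmap_id & ratcomp f (ratinv f) = ratmap_id].
Proof.
move=> bf; have [gf fg] := @xgetPex _ ratmap_id
  [set g | is_comp g f ratmap_id /\ is_comp f g ratmap_id] bf.
by rewrite /ratinv (ratcompE gf) (ratcompE fg); split => //; exists f.
Qed.

Lemma birational_comp f g : birational f -> birational g -> birational (ratcomp f g).
Proof.
move=> bf bg; have [bf' f'f ff'] := ratinvP bf; have [bg' g'g gg'] := ratinvP bg.
move: (ratinv f) (ratinv g) bf' f'f ff' bg' g'g gg' => f' g' bf' f'f ff' bg' g'g gg'.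
move/birational_dominant in bf; move/birational_dominant in bg.
move/birational_dominant in bf'; move/birational_dominant in bg'.
have dfg := dominant_comp bf bg; have dgf' := dominant_comp bg' bf'.
apply: (birationalP dfg dgf').
  rewrite -(ratcompA bg' bf' dfg) (ratcompA bf' bf bg) f'f.
  by rewrite (ratcompE (is_comp1f _)).
rewrite -(ratcompA bf bg dgf') (ratcompA bg bg' bf') gg'.
by rewrite (ratcompE (is_comp1f _)).
Qed.

Lemma birational_id : birational ratmap_id.
Proof. by exists ratmap_id; split; exact: is_comp1f. Qed.

Definition bir_of f (bf : birational f) : bir := Bir (asboolT bf).

Lemma birP (f : bir) : birational (val f).
Proof. exact/asboolP/(valP f). Qed.

Definition bir_one : bir := bir_of birational_id.
Definition bir_mul (f g : bir) : bir := bir_of (birational_comp (birP f) (birP g)).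
Definition bir_inv (f : bir) : bir :=
  bir_of (let: And3 bf _ _ := ratinvP (birP f) in bf).

Let bdom (f : bir) : dominant (val f) := birational_dominant (birP f).

Lemma bir_mulA : associative bir_mul.
Proof. by move=> f g h; apply: val_inj; apply: ratcompA; exact: bdom. Qed.

Lemma bir_mul1g : left_id bir_one bir_mul.
Proof. by move=> f; apply: val_inj; apply: ratcompE; exact: is_comp1f. Qed.

Lemma bir_mulg1 : right_id bir_one bir_mul.
Proof. by move=> f; apply: val_inj; apply: ratcompE; exact: is_compf1. Qed.

Lemma bir_mulVg : left_inverse bir_one bir_inv bir_mul.
Proof.
by move=> f; apply: val_inj; have [] := ratinvP (birP f).
Qed.

Lemma bir_mulgV : right_inverse bir_one bir_inv bir_mul.
Proof.
by move=> f; apply: val_inj; have [] := ratinvP (birP f).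
Qed.

HB.instance Definition _ :=
  isGroup.Build bir bir_mulA bir_mul1g bir_mulg1 bir_mulVg bir_mulgV.

End Homogeneous.

Section EuclideanTopology.
Variables (K : localFieldType) (n : nat).

(* The coefficients of a homogeneous tuple of degree d vanish outside the
   finitely many monomials of degree d, so this is the topology of a finite
   power of K. *)
Definition coeffs d (h : htuple K n d) : {ptws 'I_n.+1 * 'X_{1..n.+1} -> K} :=
  fun im => (tnth h im.1)@_(im.2).

HB.instance Definition _ d :=
  Topological.copy (htuple K n d) (initial_topology (@coeffs d)).

(* H_d, as a subset of W_d with the quotient topology of the projection from the
   non-zero tuples; set_type then carries the induced topology. *)
Definition birH d : set (quotient_topology (projW K n d)) := [set h | birational (psi h)].

Definition bir_pi d (h : set_type (@birH d)) : bir K n :=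
  bir_of (set_valP h).

Definition bir_le d : set (bir K n) := range (@bir_pi d).

(* bir_le d is the set of the f of degree at most d; for A contained in
   bir_le d, bir_le_open A is openness in the quotient topology of bir_pi. *)
Definition bir_le_open d (A : set (bir K n)) : Prop := open (@bir_pi d @^-1` A).

(* The inductive limit (final) topology along the bir_le d. *)
Definition bir_open (U : set (bir K n)) : Prop :=
  forall d, (1 <= d)%N -> bir_le_open d (U `&` bir_le d).

Lemma bir_openE U :
  bir_open U <-> forall d, (1 <= d)%N -> open (@bir_pi d @^-1` U).
Proof.
by split=> H d d1; have := H d d1; rewrite /bir_le_open preimage_setI
  preimage_range setIT.
Qed.

Lemma bir_openT : bir_open setT.
Proof. by apply/bir_openE => d _; rewrite preimage_setT; exact: openT. Qed.

Lemma bir_openI : setI_closed bir_open.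
Proof.
move=> U V /bir_openE oU /bir_openE oV; apply/bir_openE => d d1.
by rewrite preimage_setI; apply: openI; [exact: oU|exact: oV].
Qed.

Lemma bir_open_bigU (I : Type) (f : I -> set (bir K n)) :
  (forall i, bir_open (f i)) -> bir_open (\bigcup_i f i).
Proof.
move=> of_; apply/bir_openE => d d1; rewrite preimage_bigcup.
by apply: bigcup_open => i _; have /bir_openE := of_ i; apply.
Qed.

HB.instance Definition _ :=
  isOpenTopological.Build (bir K n) bir_openT bir_openI bir_open_bigU.

End EuclideanTopology.

Definition normal_subgroup (G : groupType) (N : set G) : Prop :=
  [/\ N 1%g, forall x y, N x -> N y -> N (x * y)%g,
      forall x, N x -> N (x^-1)%g & forall x y, N x -> N (x ^ y)%g].

(* Main.v *)
Require Import Defs.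
From mathcomp Require Import all_boot all_algebra perm generic_quotient.
From mathcomp Require Import mpoly ring.
From mathcomp Require Import boolp classical_sets functions cardinality.
From mathcomp Require Import topology_structure separation_axioms.
From mathcomp Require Import supremum_topology initial_topology function_spaces.
From mathcomp Require Import quotient_topology subtype_topology tvs.

(** Over a nondiscrete field, t = 0 is a limit of values t <> 0.  Hence, if a family c t of
    birational maps is represented by tuples of one fixed degree whose coefficients are
    continuous in t, a closed subset of Bir that contains c t for all t <> 0 contains c 0
    ([curve_closed]).  Such families are stable under products ([curveM]), which takes the
    place of the continuity of the group law.

    Families come from zooming ([zoom_limit]).  Suppose that h and its inverse are defined
    at p = [1 : 0 : ... : 0] and fix p.  When h is conjugated by the homothety of centre p
    and ratio t, the limit as t tends to 0 is the linear part of h at p, an element of PGL.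
    As the field is infinite, every birational map is of this form after linear changes of
    coordinates in the source and in the target ([general_position]).

    Let N be a closed normal subgroup that contains some f <> 1.

    - In suitable coordinates f maps p to a second coordinate point q.  A transvection g
      that fixes p and q and is tangent to the identity at p, but not at q, satisfies: the
      conjugates of f g f^-1 g^-1 by homotheties centred at q tend to g^-1.  Hence g is in N
      ([transvection_mem]).
    - Two commutators, the first of g with the quadratic map (x, y) -> (x, x y) and the
      second with an affine map in x, turn g into the dilations y -> a y
      ([dilation_mem]).
    - Conjugates of dilations generate the diagonal matrices; triangular matrices
      degenerate to their diagonal under conjugation by diagonal matrices
      ([mx_mem_weight]); a transposition is conjugate to a triangular matrix
      ([mx_mem_tperm]).  By the LUP decomposition all of PGL is in N ([lin_mem]).
    - Up to PGL an arbitrary element is a map h that fixes p.  The commutators of h with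
      homotheties are in N and, by zooming, degenerate to an element of PGL times h^-1.
      Hence h is in N ([closed_normal_full]). *)

Set Implicit Arguments.
Unset Strict Implicit.
Unset Printing Implicit Defensive.

Import GRing.Theory.
Local Open Scope classical_set_scope.
Local Open Scope ring_scope.
Local Open Scope quotient_scope.

(** * Birational maps and the tuples that represent them *)

Section Representatives.
Variables (K : fieldType) (n : nat).
Local Notation P := {mpoly K[n.+1]}.
Local Notation tuples := (n.+1.-tuple P).
Implicit Types (u v w : tuples) (f g : bir K n).

Definition homogeneous d u := forall i, tnth u i \is d.-homog.
Definition nonzero u := exists i, tnth u i != 0.
Definition proportional u v := forall i j, tnth u i * tnth v j = tnth u j * tnth v i.
Definition id_tuple : tuples := [tuple 'X_i | i < n.+1].

(** Tuples of polynomials are easier to compose than classes of rational maps; all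
    identities between birational maps are checked on representing tuples, up to
    proportionality. *)
Definition represents f u := exists F : rrep K n, \pi_(ratmap K n) F = val f /\ rtuple F = u.

Lemma proportional_refl u : proportional u u.
Proof. by move=> i j; rewrite mulrC. Qed.

Lemma proportional_of_scaled u v (a b : P) : a != 0 ->
  (forall i, a * tnth u i = b * tnth v i) -> proportional u v.
Proof.
move=> a0 E i j; apply: (mulfI a0); rewrite !mulrA !E.
by rewrite -!mulrA; congr (_ * _); rewrite mulrC.
Qed.

Lemma tnth_tcomp u v i : tnth (tcomp u v) i = tnth u i \mPo v.
Proof. by rewrite tnth_mktuple. Qed.

Lemma comp_X i u : 'X_i \mPo u = tnth u i.
Proof. by rewrite comp_mpolyXU -tnth_nth. Qed.

Lemma id_tuple_nonzero : nonzero id_tuple.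
Proof. by exists ord0; rewrite tnth_mktuple -msupp_eq0 msuppX. Qed.

Lemma rrep_intro d u : homogeneous d u -> nonzero u -> exists F : rrep K n, rtuple F = u.
Proof.
move=> hu [i ui].
have H : all (fun p => p \is d.-homog) u && has (fun p => p != 0) u.
  by apply/andP; split; [exact/all_tnthP | apply/hasP; exists (tnth u i); rewrite ?mem_tnth].
by exists (Tagged _ (HTuple H) : rrep K n).
Qed.

Lemma represents_nonzero f u : represents f u -> nonzero u.
Proof. by move=> [F [_ <-]]; exact: rtuple_neq0. Qed.

Lemma represents_homog f u : represents f u -> exists d, homogeneous d u.
Proof. by move=> [F [_ <-]]; exists (tag F) => i; exact: rtuple_homog. Qed.

Lemma represents_exists f : exists u, represents f u.
Proof. by exists (rtuple (repr (val f))), (repr (val f)); rewrite reprK. Qed.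

Lemma proportional_of_represents f u v :
  represents f u -> represents f v -> proportional u v.
Proof.
by move=> [F [hF <-]] [G [hG <-]]; apply/reqP; apply/eqmodP; rewrite hF hG.
Qed.

Lemma represents_inj f g u v :
  represents f u -> represents g v -> proportional u v -> f = g.
Proof.
move=> [F [hF <-]] [G [hG <-]] /reqP /eqmodP E; apply: val_inj.
by rewrite -hF -hG.
Qed.

Lemma represents_proportional f d u v :
  represents f u -> homogeneous d v -> nonzero v -> proportional u v -> represents f v.
Proof.
move=> [F [hF Fu]] hv v0 uv; have [G Gv] := rrep_intro hv v0.
exists G; split=> //; rewrite -hF; apply/esym/eqmodP/reqP.
by rewrite Fu Gv.
Qed.

Lemma represents_dominant f u d (p : P) :
  represents f u -> p \is d.-homog -> p != 0 -> p \mPo u != 0.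
Proof.
move=> [F [hF <-]]; apply: dominantP; rewrite hF.
exact: birational_dominant (birP f).
Qed.

Lemma tcomp_homog d e u v :
  homogeneous d u -> homogeneous e v -> homogeneous (e * d) (tcomp u v).
Proof. by move=> hu hv i; rewrite tnth_mktuple; exact: dhomog_comp. Qed.

Lemma represents_mul f g u v :
  represents f u -> represents g v -> represents (f * g)%g (tcomp u v).
Proof.
move=> [F [hF <-]] [G [hG <-]].
have dG : dominant (\pi_(ratmap K n) G).
  by rewrite hG; exact: birational_dominant (birP g).
have [E hE] := rcomp_ex F (dominantP dG).
exists E; split=> //; symmetry; apply: ratcompE.
by exists F, G, E; split.
Qed.

Lemma represents_one : represents 1%g id_tuple.
Proof. by exists (rrep_id K n). Qed.

(** Explicit formulas for a map and its inverse compose to the identity up to a common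
    factor of the coordinates, which proportionality absorbs. *)
Lemma bir_intro d e u v : homogeneous d u -> homogeneous e v ->
    nonzero (tcomp u v) -> nonzero (tcomp v u) ->
    proportional (tcomp u v) id_tuple -> proportional (tcomp v u) id_tuple ->
  exists f : bir K n, represents f u /\ represents f^-1%g v.
Proof.
have nzl a b : nonzero (tcomp a b) -> nonzero a.
  move=> [i]; rewrite tnth_mktuple => ai; exists i.
  by apply: contraNneq ai => ->; rewrite comp_mpoly0.
move=> hu hv uv0 vu0 uv vu.
have [F hF] := rrep_intro hu (nzl _ _ uv0).
have [G hG] := rrep_intro hv (nzl _ _ vu0).
have [FG hFG] := rrep_intro (tcomp_homog hu hv) uv0.
have [GF hGF] := rrep_intro (tcomp_homog hv hu) vu0.
have cGF : is_comp (\pi_(ratmap K n) G) (\pi_(ratmap K n) F) (ratmap_id K n).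
  exists G, F, GF; split=> //; last by rewrite hGF hG hF.
  by apply/eqmodP/reqP; rewrite hGF; exact: vu.
have cFG : is_comp (\pi_(ratmap K n) F) (\pi_(ratmap K n) G) (ratmap_id K n).
  exists F, G, FG; split=> //; last by rewrite hFG hG hF.
  by apply/eqmodP/reqP; rewrite hFG; exact: uv.
have bF : birational (\pi_(ratmap K n) F) by exists (\pi_(ratmap K n) G).
have bG : birational (\pi_(ratmap K n) G) by exists (\pi_(ratmap K n) F).
have E : (bir_of bF * bir_of bG)%g = 1%g :> bir K n.
  by apply: val_inj; exact: ratcompE.
exists (bir_of bF); split; first by exists F.
by rewrite (mulg1_eq E); exists G.
Qed.

Lemma X_neq0 i : 'X_i != 0 :> P.
Proof. by rewrite -msupp_eq0 msuppX. Qed.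

(** Multiplying by X_0 raises the degree of a representative.  This makes the degree
    positive, as the inductive limit topology demands, and leaves the value at a point
    with X_0 = 1 unchanged. *)
Lemma raise_homog d u : homogeneous d u ->
  homogeneous d.+1 [tuple 'X_ord0 * tnth u i | i < n.+1].
Proof.
move=> hu i; rewrite tnth_mktuple -[d.+1]/(1 + d)%N; apply: dhomogM; last exact: hu.
by rewrite dhomogX; apply/eqP/mdeg1.
Qed.

Lemma represents_raise f u : represents f u ->
  represents f [tuple 'X_ord0 * tnth u i | i < n.+1].
Proof.
move=> fu; have [d hu] := represents_homog fu; apply: (represents_proportional fu (raise_homog hu)).
  have [i ui] := represents_nonzero fu; exists i; rewrite tnth_mktuple mulf_neq0 //.
  exact: X_neq0.
by move=> i j; rewrite !tnth_mktuple mulrCA [RHS]mulrCA (mulrC (tnth u i)).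
Qed.

Lemma represents_inv f u v :
  represents f u -> represents f^-1%g v -> proportional (tcomp v u) id_tuple.
Proof.
move=> fu fv; apply: proportional_of_represents (represents_mul fv fu) _.
by rewrite mulVg; exact: represents_one.
Qed.

End Representatives.

(** * Continuity in a nondiscrete field *)

Section Continuity.
Variable K : localFieldType.

Lemma continuousD (T : topologicalType) (f g : T -> K) :
  continuous f -> continuous g -> continuous (fun t => f t + g t).
Proof.
move=> cf cg t; apply: (@continuous2_cvg _ _ _ _ _ _ f g (fun x y => x + y)).
- exact: (@add_continuous K (f t, g t)).
- exact: cf.
- exact: cg.
Qed.

Lemma continuousM (T : topologicalType) (f g : T -> K) :
  continuous f -> continuous g -> continuous (fun t => f t * g t).
Proof.
move=> cf cg t; apply: (@continuous2_cvg _ _ _ _ _ _ f g (fun x y => x * y)).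
- exact: (@local_mul_continuous K (f t, g t)).
- exact: cf.
- exact: cg.
Qed.

Lemma continuousX k : continuous (fun t : K => t ^+ k).
Proof.
elim: k => [|k ih]; first exact: cst_continuous.
have -> : (fun t : K => t ^+ k.+1) = (fun t => t * t ^+ k) by apply/funext=> t; rewrite exprS.
by apply: continuousM => //; move=> ?; exact: cvg_id.
Qed.

Lemma continuous_sum (T : topologicalType) (I : Type) (r : seq I) (Q : pred I) (F : I -> T -> K) :
  (forall i, continuous (F i)) -> continuous (fun t => \sum_(i <- r | Q i) F i t).
Proof.
move=> cF; apply: continuous_big; first exact: add_continuous.
by move=> i _; exact: cF.
Qed.

Lemma closed_point (a : K) : closed [set a].
Proof. exact/accessible_closed_set1/hausdorff_accessible/local_hausdorff. Qed.

(** Otherwise all points would be open, by translation, and the field discrete. *)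
Lemma zero_not_open : ~ open [set (0 : K)].
Proof.
move=> o0; apply: (@local_nondiscrete K) => A.
have opt (a : K) : open [set a].
  have -> : [set a] = (fun t => t + - a) @^-1` [set 0].
    by apply/seteqP; split => x /=; [move=> ->; rewrite subrr | move/subr0_eq].
  have /continuousP : continuous (fun t : K => t + - a).
    by apply: continuousD; [by move=> ?; exact: cvg_id | exact: cst_continuous].
  exact.
rewrite (_ : A = \bigcup_(a in A) [set a]); first exact: bigcup_open.
by apply/seteqP; split => x; [exists x | move=> [y Ay ->]].
Qed.

(** The parameter t = 0 is a limit of parameters t <> 0: this is what lets closed
    sets and identities pass to the limit. *)
Lemma closed_punctured (A : set K) : closed A -> (forall t, t != 0 -> A t) -> A 0.
Proof.
move=> cA At; apply/not_notP => A0; apply: zero_not_open.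
have -> : [set 0] = ~` A.
  apply/seteqP; split => t /=; first by move=> ->.
  by apply: contra_notP => /eqP; exact: At.
by rewrite openC.
Qed.

Lemma continuous_vanish (f : K -> K) :
  continuous f -> (forall t, t != 0 -> f t = 0) -> f 0 = 0.
Proof.
move=> /continuous_closedP cf f0.
exact: (closed_punctured (cf _ (@closed_point 0)) f0).
Qed.

(** A finite Hausdorff space is discrete. *)
Lemma infinite_field (s : seq K) : exists x, x \notin s.
Proof.
apply/not_existsP => H; apply: zero_not_open; rewrite -[X in open X]setCK openC.
move/hausdorff_accessible/accessible_finite_set_closed : (@local_hausdorff K); apply.
apply: (@sub_finite_set _ _ [set` s]); last exact: finite_seq.
by move=> x _; move: (H x) => /negP; rewrite negbK.
Qed.

End Continuity.

(** * Curves of birational maps and their limits *)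

Section Curves.
Variables (K : localFieldType) (n : nat).
Local Notation P := {mpoly K[n.+1]}.
Local Notation tuples := (n.+1.-tuple P).

Definition continuous_family (p : K -> P) := forall m, continuous (fun t => (p t)@_m).

Lemma continuous_family_cst p : continuous_family (fun=> p).
Proof. by move=> m; exact: cst_continuous. Qed.

Lemma continuous_familyD p q :
  continuous_family p -> continuous_family q -> continuous_family (fun t => p t + q t).
Proof.
move=> cp cq m; rewrite (_ : (fun t => _) = (fun t => (p t)@_m + (q t)@_m)).
  exact: continuousD.
by apply/funext=> t; rewrite mcoeffD.
Qed.

Lemma continuous_familyM p q :
  continuous_family p -> continuous_family q -> continuous_family (fun t => p t * q t).
Proof.
move=> cp cq m.
rewrite (_ : (fun t => _) = (fun t => \sum_(k : 'X_{1..n.+1 < (mdeg m).+1, (mdeg m).+1} |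
    m == (k.1 + k.2)%MM) ((p t)@_k.1 * (q t)@_k.2))).
  by apply: continuous_sum => k; exact: continuousM.
by apply/funext=> t; rewrite mcoeffM.
Qed.

Lemma continuous_family_prod (I : Type) (r : seq I) (F : I -> K -> P) :
  (forall i, continuous_family (F i)) -> continuous_family (fun t => \prod_(i <- r) F i t).
Proof.
move=> cF; elim: r => [|i r ih].
  by rewrite (_ : (fun t => _) = fun=> 1); [exact: continuous_family_cst |
    apply/funext => t; rewrite big_nil].
rewrite (_ : (fun t => _) = fun t => F i t * \prod_(i <- r) F i t); first exact: continuous_familyM.
by apply/funext => t; rewrite big_cons.
Qed.

Lemma continuous_familyX p k : continuous_family p -> continuous_family (fun t => p t ^+ k).
Proof.
move=> cp; rewrite (_ : (fun t => _) = fun t => \prod_(i <- iota 0 k) p t).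
  exact: continuous_family_prod.
by apply/funext => t; rewrite big_const_seq count_predT size_iota -Monoid.iteropE.
Qed.

Lemma homog_msize d (p : P) : p \is d.-homog -> (msize p <= d.+1)%N.
Proof.
move=> /dhomogP hp; rewrite mmeasureE big_seq.
by apply/bigmax_leqP_seq => m + _ => mp; rewrite (hp m mp).
Qed.

(** The common degree d bounds the supports of the p t, so that the composition is a
    sum over a range that is independent of t. *)
Lemma continuous_family_comp d (p : K -> P) (u : K -> tuples) :
  (forall t, p t \is d.-homog) -> continuous_family p ->
  (forall i, continuous_family (fun t => tnth (u t) i)) -> continuous_family (fun t => p t \mPo u t).
Proof.
move=> hp cp cu m.
rewrite (_ : (fun t => _) = (fun t => \sum_(k : 'X_{1..n.+1 < d.+1})
    (p t)@_k * (\prod_i tnth (u t) i ^+ k i)@_m)).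
  apply: continuous_sum => k; apply: continuousM; first exact: cp.
  by apply: continuous_family_prod => i; apply: continuous_familyX.
apply/funext=> t; rewrite (comp_mpolywE _ (homog_msize (hp t))) raddf_sum /=.
by apply: eq_bigr => k _; rewrite mcoeffZ.
Qed.

Lemma continuous_family_vanish p :
  continuous_family p -> (forall t, t != 0 -> p t = 0) -> p 0 = 0.
Proof.
move=> cp p0; apply/mpolyP=> m; rewrite mcoeff0; apply: continuous_vanish (cp m) _ => t t0.
by rewrite p0 // mcoeff0.
Qed.

Definition homog_family d (u : K -> tuples) :=
  (forall t, homogeneous d (u t)) /\ (forall i, continuous_family (fun t => tnth (u t) i)).

(** A single degree for all t keeps the curve inside one step of the inductive limit. *)
Definition curve (c : K -> bir K n) :=
  exists d u, homog_family d u /\ forall t, represents (c t) (u t).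

Lemma homog_family_cst d (u : tuples) : homogeneous d u -> homog_family d (fun=> u).
Proof. by move=> hu; split=> // i; exact: continuous_family_cst. Qed.

Lemma homog_family_comp d e u v : homog_family d u -> homog_family e v ->
  homog_family (e * d) (fun t => tcomp (u t) (v t)).
Proof.
move=> [hu cu] [hv cv]; split=> [t|i]; first exact: tcomp_homog.
rewrite (_ : (fun t => _) = fun t => tnth (u t) i \mPo v t).
  by apply: (@continuous_family_comp d) => // t; exact: hu.
by apply/funext=> t; rewrite tnth_mktuple.
Qed.

Lemma curve_cst f : curve (fun=> f).
Proof.
have [u fu] := represents_exists f; have [d hu] := represents_homog fu.
by exists d, (fun=> u); split=> //; exact: homog_family_cst.
Qed.

Lemma curveM c c' : curve c -> curve c' -> curve (fun t => c t * c' t)%g.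
Proof.
move=> [d [u [hu cu]]] [e [v [hv cv]]]; exists (e * d)%N, (fun t => tcomp (u t) (v t)).
by split=> [|t]; [exact: homog_family_comp | exact: represents_mul].
Qed.

(** The topology of tuples is initial for the coefficients, and so is the product
    topology for its coordinates. *)
Lemma htuple_continuous d (h : K -> htuple K n d) :
  (forall i m, continuous (fun t => (tnth (h t) i)@_m)) -> continuous h.
Proof.
move=> ch; apply: (@continuous_comp_initial _ _ _ (@coeffs K n d) h).
move=> t; apply/cvg_sup => im.
have : continuous ((fun t => (@coeffs K n d \o h) t) :
    K -> initial_topology (fun f : (forall _ : 'I_n.+1 * 'X_{1..n.+1}, K) => f im)).
  apply: continuous_comp_initial; exact: (ch im.1 im.2).
exact.
Qed.

Lemma curve_pos c : curve c ->
  exists d u, homog_family d.+1 u /\ forall t, represents (c t) (u t).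
Proof.
move=> [d [u [[hu cu] ru]]]; exists d, (fun t => [tuple 'X_ord0 * tnth (u t) i | i < n.+1]).
split; last by move=> t; exact: represents_raise.
split=> [t|i]; first exact: raise_homog.
rewrite (_ : (fun t => _) = fun t => 'X_ord0 * tnth (u t) i).
  by apply: continuous_familyM => //; exact: continuous_family_cst.
by apply/funext=> t; rewrite tnth_mktuple.
Qed.

(** The lifting of c to tuples is continuous, hence so is its class in W_d; as every
    c t is birational, c factors continuously through H_d, and the set of t such that
    N (c t) is closed in K. *)
Lemma curve_closed (N : set (bir K n)) c : closed N -> curve c ->
  (forall t, t != 0 -> N (c t)) -> N (c 0).
Proof.
move=> cN /curve_pos[d [u [[hu cu] ru]]].
have H t : all (fun p => p \is (d.+1).-homog) (u t) && has (fun p => p != 0) (u t).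
  apply/andP; split; first by apply/all_tnthP => i; exact: hu.
  by have [i ui] := represents_nonzero (ru t); apply/hasP; exists (tnth (u t) i); rewrite ?mem_tnth.
pose h t : htuple K n d.+1 := HTuple (H t).
have ch : continuous h by apply: htuple_continuous => i m; exact: (cu i m).
pose w t : quotient_topology (projW K n d.+1) := \pi_(projW K n d.+1) (h t).
have cw : continuous w.
  move=> t; apply: continuous_comp; first exact: ch.
  exact: (@pi_continuous _ (projW K n d.+1)).
have pw t : psi (w t) = val (c t).
  rewrite /w psiE; have [F [<- Fu]] := ru t.
  by apply/eqmodP/reqP => i j; rewrite Fu /rtuple /= mulrC.
have bw t : @birH K n d.+1 (w t) by rewrite /birH /= pw; exact: birP.
pose b t : set_type (@birH K n d.+1) := exist _ (w t) (mem_set (bw t)).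
have cb : continuous b by apply: continuous_comp_initial; exact: cw.
have bc t : bir_pi (b t) = c t by apply: val_inj; exact: pw.
rewrite -bc => Nc.
have clN : closed ((@bir_pi K n d.+1) @^-1` N).
  rewrite -openC preimage_setC; move: cN; rewrite -openC => /bir_openE; exact.
move/continuous_closedP: cb => /(_ _ clN) clK.
by apply: (closed_punctured clK) => t /Nc; rewrite /= bc.
Qed.

End Curves.

(** * Linear maps, and points *)

Section Linear.
Variables (K : fieldType) (n : nat).
Local Notation P := {mpoly K[n.+1]}.
Local Notation tuples := (n.+1.-tuple P).
Local Notation M := 'M[K]_n.+1.
Implicit Types (A B : M) (u v : tuples) (f g : bir K n).

Definition lin_tuple A : tuples := [tuple \sum_j A i j *: 'X_j | i < n.+1].

Lemma lin_tuple_homog A : homogeneous 1 (lin_tuple A).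
Proof.
move=> i; rewrite tnth_mktuple; apply: rpred_sum => j _; apply: dhomogZ.
by rewrite dhomogX; apply/eqP/mdeg1.
Qed.

Lemma comp_lin_tuple A u i : tnth (lin_tuple A) i \mPo u = \sum_j A i j *: tnth u j.
Proof.
rewrite tnth_mktuple raddf_sum /=; apply: eq_bigr => j _.
by rewrite comp_mpolyZ comp_mpolyXU -tnth_nth.
Qed.

Lemma lin_tuple_mul A B : tcomp (lin_tuple A) (lin_tuple B) = lin_tuple (A *m B).
Proof.
apply: eq_from_tnth => i; rewrite tnth_mktuple comp_lin_tuple tnth_mktuple.
under eq_bigr => j _ do rewrite tnth_mktuple scaler_sumr.
rewrite exchange_big; apply: eq_bigr => k _; rewrite mxE scaler_suml.
by apply: eq_bigr => j _; rewrite scalerA.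
Qed.

Lemma lin_tuple1 : lin_tuple 1%:M = id_tuple K n.
Proof.
apply: eq_from_tnth => i; rewrite !tnth_mktuple (bigD1 i) //= mxE eqxx scale1r.
by rewrite big1 ?addr0 // => j ji; rewrite mxE eq_sym (negPf ji) scale0r.
Qed.

Lemma lin_tuple_diag (d : 'rV[K]_n.+1) i : tnth (lin_tuple (diag_mx d)) i = d 0 i *: 'X_i.
Proof.
rewrite tnth_mktuple (bigD1 i) //= mxE eqxx mulr1n big1 ?addr0 // => j ji.
by rewrite mxE (eq_sym i j) (negPf ji) mulr0n scale0r.
Qed.

Lemma diag_unit (d : 'rV[K]_n.+1) : (forall i, d 0 i != 0) -> diag_mx d \in unitmx.
Proof.
move=> d0; rewrite unitmxE det_diag unitfE prodf_seq_neq0; apply/allP => i _ /=; exact: d0.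
Qed.

Lemma lin_subproof A : A \in unitmx ->
  exists f, represents f (lin_tuple A) /\ represents f^-1%g (lin_tuple (invmx A)).
Proof.
move=> uA; apply: (bir_intro (lin_tuple_homog A) (lin_tuple_homog (invmx A))); rewrite lin_tuple_mul.
all: rewrite ?mulVmx ?mulmxV // lin_tuple1.
all: first [exact: id_tuple_nonzero | exact: proportional_refl].
Qed.

(** A total function of A, with value 1 outside GL_(n+1), so that families of matrices
    need not carry proofs of invertibility. *)
Definition lin A : bir K n := xget 1%g [set f | represents f (lin_tuple A)].

Lemma lin_represents A : A \in unitmx -> represents (lin A) (lin_tuple A).
Proof.
move=> /lin_subproof[f [fA _]].
by apply: (@xgetPex _ 1%g [set f | represents f (lin_tuple A)]); exists f.
Qed.

Lemma lin_eq f A : A \in unitmx -> represents f (lin_tuple A) -> f = lin A.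
Proof.
by move=> uA fA; apply: represents_inj fA (lin_represents uA) _; exact: proportional_refl.
Qed.

Lemma lin_mul A B : A \in unitmx -> B \in unitmx -> lin (A *m B) = (lin A * lin B)%g.
Proof.
move=> uA uB; symmetry; apply: lin_eq; first by rewrite unitmx_mul uA.
by rewrite -lin_tuple_mul; apply: represents_mul; exact: lin_represents.
Qed.

Lemma lin_1 : lin 1%:M = 1%g.
Proof. by symmetry; apply: lin_eq; rewrite ?unitmx1 // lin_tuple1; exact: represents_one. Qed.

Lemma lin_inv A : A \in unitmx -> lin (invmx A) = (lin A)^-1%g.
Proof.
move=> uA; apply/esym/mulg1_eq; rewrite -lin_mul ?unitmx_inv // mulmxV //.
exact: lin_1.
Qed.

(** A linear relation v between the rows of A would be a linear form that vanishes on
    the image of f, which is dense. *)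
Lemma lin_tuple_unit f A : represents f (lin_tuple A) -> A \in unitmx.
Proof.
move=> fA; rewrite -row_free_unit -kermx_eq0; apply/rowV0P => v /sub_kermxP vA.
apply/eqP/negP => /negP v0.
pose p : P := \sum_j v 0 j *: 'X_j.
have pj j : p@_U_(j) = v 0 j.
  rewrite raddf_sum (bigD1 j) //= mcoeffZ mcoeffXU eqxx mulr1 big1 ?addr0 //.
  by move=> k kj; rewrite mcoeffZ mcoeffXU (negPf kj) mulr0.
have p0 : p != 0.
  apply: contraNneq v0 => p0; apply/eqP/rowP => j.
  by rewrite -pj p0 mcoeff0 mxE.
have hp : p \is 1.-homog.
  apply: rpred_sum => j _; apply: dhomogZ.
  by rewrite dhomogX; apply/eqP/mdeg1.
have /negP := represents_dominant fA hp p0; apply; apply/eqP.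
rewrite raddf_sum /=.
under eq_bigr => j _ do rewrite comp_mpolyZ comp_mpolyXU -tnth_nth tnth_mktuple scaler_sumr.
rewrite exchange_big big1 // => k _.
under eq_bigr => j _ do rewrite scalerA.
rewrite -scaler_suml.
by have /rowP/(_ k) := vA; rewrite !mxE => ->; rewrite scale0r.
Qed.

Implicit Types (x y z : 'cV[K]_n.+1).

Definition ev (p : P) x := p.@[fun j => x j 0].

Lemma ev_homog d p a x : p \is d.-homog -> ev p (a *: x) = a ^+ d * ev p x.
Proof.
move=> /dhomogP hp; rewrite /ev !mevalE mulr_sumr big_seq [RHS]big_seq.
apply: eq_bigr => m mp; rewrite mulrCA; congr (_ * _).
rewrite -(hp m mp) /= mdegE -prodrXr -big_split /=.
by apply: eq_bigr => i _; rewrite mxE exprMn.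
Qed.

Lemma ev_comp p u x : ev (p \mPo u) x = ev p (\col_i ev (tnth u i) x).
Proof. by rewrite /ev comp_mpoly_meval; apply: meval_eq => i; rewrite mxE. Qed.

(** f is defined at the point of homogeneous coordinates x, with value y; the scalar a
    accounts for the choice of coordinates of the value. *)
Definition sends f x y := exists u a,
  [/\ represents f u, a != 0 & forall i, ev (tnth u i) x = a * y i 0].

Lemma sends_mul f g x y z : sends g x y -> sends f y z -> sends (f * g)%g x z.
Proof.
move=> [v [b [gv b0 hv]]] [u [a [fu a0 hu]]]; have [d du] := represents_homog fu.
exists (tcomp u v), (b ^+ d * a); split; first exact: represents_mul.
  by rewrite mulf_neq0 // expf_neq0.
move=> i; rewrite tnth_mktuple ev_comp.
have -> : \col_i ev (tnth v i) x = b *: y by apply/colP => j; rewrite !mxE hv.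
by rewrite (ev_homog _ _ (du i)) hu mulrA.
Qed.

Lemma ev_lin_tuple A x i : ev (tnth (lin_tuple A) i) x = (A *m x) i 0.
Proof.
rewrite tnth_mktuple /ev raddf_sum mxE; apply: eq_bigr => j _.
by rewrite /= mevalZ mevalXU.
Qed.

Lemma sends_lin A x y : A \in unitmx -> A *m x = y -> sends (lin A) x y.
Proof.
move=> uA <-; exists (lin_tuple A), 1; split; [exact: lin_represents | exact: oner_neq0 |].
by move=> i; rewrite ev_lin_tuple mul1r.
Qed.

(** The substitute for an invertible derivative at x. *)
Definition local_iso f x y := sends f x y /\ sends f^-1%g y x.

Lemma local_iso_mul f g x y z :
  local_iso g x y -> local_iso f y z -> local_iso (f * g)%g x z.
Proof.
move=> [g1 g2] [f1 f2]; split; first exact: sends_mul g1 f1.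
by rewrite invgM; exact: sends_mul f2 g2.
Qed.

Lemma local_iso_lin A x y : A \in unitmx -> A *m x = y -> local_iso (lin A) x y.
Proof.
move=> uA Axy; split; first exact: sends_lin.
rewrite -lin_inv //; apply: sends_lin; first by rewrite unitmx_inv.
by rewrite -Axy mulKmx.
Qed.

End Linear.

Lemma curve_lin (K : localFieldType) n (C : K -> 'M[K]_n.+1) :
  (forall t, C t \in unitmx) -> (forall i j, continuous (fun t => C t i j)) ->
  curve (fun t => lin (C t)).
Proof.
move=> uC cC; exists 1%N, (fun t => lin_tuple (C t)); split; last by move=> t; exact: lin_represents.
split=> [t|i m]; first exact: lin_tuple_homog.
rewrite (_ : (fun t => _) = fun t => \sum_j C t i j * ('X_j : {mpoly K[n.+1]})@_m).
  by apply: continuous_sum => j; apply: continuousM; [exact: cC | exact: cst_continuous].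
apply/funext => t; rewrite tnth_mktuple raddf_sum /=.
by apply: eq_bigr => j _; rewrite mcoeffZ.
Qed.

(** * Zooming at a fixed point *)

Section Contraction.
Variables (K : localFieldType) (n : nat).
Local Notation P := {mpoly K[n.+1]}.
Local Notation tuples := (n.+1.-tuple P).
Local Notation M := 'M[K]_n.+1.

Definition origin : 'cV[K]_n.+1 := delta_mx ord0 0.
(** The exponent of t in m (X_0, t X_1, ..., t X_n): the degree in the affine
    coordinates around the origin [1 : 0 : ... : 0]. *)
Definition weight (m : 'X_{1..n.+1}) : nat := \sum_(i | i != ord0) m i.
(** For k <= 1 this is t^-k p (X_0, t X_1, ..., t X_n), written without division so that
    it makes sense at t = 0.  The subtraction is truncated, hence for k = 1 the formula
    is the intended one only if p has no term of weight 0, that is if p vanishes at the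
    origin. *)
Definition rescale k (t : K) (p : P) : P :=
  \sum_(m <- msupp p) (p@_m * t ^+ (weight m - k)) *: 'X_[m].
Definition homothety (t : K) : M := diag_mx (\row_i if i == ord0 then 1 else t).

Lemma rescale_coef k t p m : (rescale k t p)@_m = p@_m * t ^+ (weight m - k).
Proof.
rewrite /rescale raddf_sum /=.
have [mp|mp] := boolP (m \in msupp p).
  rewrite (bigD1_seq m) //= mcoeffZ mcoeffX eqxx mulr1 big1 ?addr0 // => j jm.
  by rewrite mcoeffZ mcoeffX (negPf jm) mulr0.
rewrite (memN_msupp_eq0 mp) mul0r big1_seq // => j /andP[_ jp].
by rewrite mcoeffZ mcoeffX; case: eqP mp => [<-|]; rewrite ?jp ?mulr0.
Qed.

Lemma rescale_homog d k t p : p \is d.-homog -> rescale k t p \is d.-homog.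
Proof.
move=> /dhomogP hp; rewrite /rescale big_seq; apply: rpred_sum => m mp.
by apply: dhomogZ; rewrite dhomogX; apply/eqP/hp.
Qed.

Lemma rescale_continuous k p : continuous_family (fun t => rescale k t p).
Proof.
move=> m; rewrite (_ : (fun t => _) = fun t => p@_m * t ^+ (weight m - k)).
  by apply: continuousM; [exact: cst_continuous | exact: continuousX].
by apply/funext=> t; rewrite rescale_coef.
Qed.

Lemma tnth_homothety t i :
  tnth (lin_tuple (homothety t)) i = (if i == ord0 then 1 else t) *: 'X_i.
Proof. by rewrite lin_tuple_diag mxE. Qed.

Lemma comp_homothety t (p : P) : p \mPo lin_tuple (homothety t) = rescale 0 t p.
Proof.
rewrite comp_mpolyE /rescale; apply: eq_bigr => m _; rewrite -scalerA; congr (_ *: _).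
rewrite subn0 (mpolyXE_id K m) /weight -prodrXr (bigD1 ord0) //=.
rewrite [X in _ = _ *: X](bigD1 ord0) //=.
rewrite tnth_homothety eqxx scale1r scalerAr; congr (_ * _).
rewrite -mul_mpolyC rmorph_prod -big_split /=; apply: eq_bigr => i i0.
by rewrite tnth_homothety (negPf i0) -mul_mpolyC exprMn rmorphXn.
Qed.

Lemma mdeg_weight (m : 'X_{1..n.+1}) : mdeg m = (m ord0 + weight m)%N.
Proof. by rewrite mdegE (bigD1 ord0). Qed.

Lemma weight_eq0 (m : 'X_{1..n.+1}) : weight m = 0%N -> m = (U_(ord0) *+ mdeg m)%MM.
Proof.
move=> w0; have m0 : mdeg m = m ord0 by rewrite mdeg_weight w0 addn0.
apply/mnmP => i; rewrite mulmnE mnm1E m0; have [<-|] := eqVneq ord0 i; first by rewrite mul1n.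
rewrite eq_sym => i0; move/eqP: w0; rewrite /weight sum_nat_eq0 => /forallP/(_ i)/implyP/(_ i0).
by move=> /eqP ->.
Qed.

Lemma weight_U0 d : weight (U_(ord0) *+ d)%MM = 0%N.
Proof. by apply/big1 => i i0; rewrite mulmnE mnm1E eq_sym (negPf i0). Qed.

Lemma weightD m1 m2 : weight (m1 + m2)%MM = (weight m1 + weight m2)%N.
Proof. by rewrite /weight -big_split; apply: eq_bigr => i _; rewrite mnmDE. Qed.

Lemma weight_U i : weight U_(i)%MM = (i != ord0).
Proof.
have := mdeg_weight U_(i)%MM; rewrite mdeg1 mnm1E; case: eqP => //= _.
by rewrite add1n => -[].
Qed.

Lemma weight_eq1 (m : 'X_{1..n.+1}) : weight m = 1%N ->
  exists2 j, j != ord0 & m = (U_(ord0) *+ (mdeg m).-1 + U_(j))%MM.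
Proof.
move=> w1; have /existsP[j /andP[j0 mj]] : [exists i, (i != ord0) && (m i != 0%N)].
  apply: contraT; rewrite negb_exists => /forallP H; suff : weight m = 0%N by rewrite w1.
  by apply: big1 => i i0; have := H i; rewrite i0 negbK => /eqP.
have le : (U_(j) <= m)%MM by apply/mnm_lepP => i; rewrite mnm1E; case: eqP => [<-|] //; rewrite lt0n.
have := submK le; set m' := (m - _)%MM => Em.
have : weight m' = 0%N.
  by apply/eqP; rewrite -(eqn_add2r (weight U_(j)%MM)) -weightD Em w1 weight_U j0.
move/weight_eq0 => Em'; exists j => //.
have -> : (mdeg m).-1 = mdeg m' by rewrite -Em mdegD mdeg1 addn1.
by rewrite -Em' Em.
Qed.

Lemma ev_origin d (p : P) : p \is d.-homog -> ev p origin = p@_(U_(ord0) *+ d)%MM.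
Proof.
move=> /dhomogP hp; rewrite /ev mevalE [in RHS](mpolyE p) raddf_sum /= big_seq [RHS]big_seq.
apply: eq_bigr => m mp; rewrite mcoeffZ mcoeffX; congr (_ * _).
have <- := hp m mp; rewrite /=.
have [w0|w0] := eqVneq (weight m) 0%N.
  rewrite -(weight_eq0 w0) eqxx big1 // => i _; rewrite /origin mxE andbT.
  have [_|i0] := eqVneq i ord0; first by rewrite expr1n.
  suff -> : m i = 0%N by [].
  move/eqP: w0; rewrite /weight sum_nat_eq0 => /forallP/(_ i)/implyP/(_ i0) /eqP //.
have -> : (m == U_(ord0) *+ mdeg m)%MM = false.
  by apply/eqP => E; move: w0; rewrite E weight_U0.
have /existsP[j /andP[j0 mj]] : [exists i, (i != ord0) && (m i != 0%N)].
  apply: contraT; rewrite negb_exists => /forallP H; move/negP: w0; case; apply/eqP.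
  by apply: big1 => i i0; have := H i; rewrite i0 negbK => /eqP.
by rewrite (bigD1 j) //= /origin mxE (negPf j0) expr0n (negPf mj) mul0r.
Qed.

Lemma coef_weight0 d (p : P) m :
  p \is d.-homog -> weight m = 0%N -> ev p origin = 0 -> p@_m = 0.
Proof.
move=> hp w0 p0; have [md|md] := eqVneq (mdeg m) d; last exact: (dhomog_nemf_coeff hp).
by rewrite (weight_eq0 w0) md -(ev_origin hp).
Qed.

Lemma ev_rescale d k t (p : P) :
  p \is d.-homog -> ev (rescale k t p) origin = ev p origin.
Proof.
by move=> hp; rewrite !(ev_origin (d := d)) ?rescale_homog // rescale_coef weight_U0 mulr1.
Qed.

Lemma rescale_shift d t (p : P) :
  p \is d.-homog -> ev p origin = 0 -> t *: rescale 1 t p = rescale 0 t p.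
Proof.
move=> hp p0; apply/mpolyP => m; rewrite mcoeffZ !rescale_coef mulrCA; case w: (weight m) => [|k].
  by rewrite (coef_weight0 hp w p0) !mul0r.
by rewrite subn0 subn1 exprS.
Qed.

(** The conjugate of u by the homothety of ratio t, with the factor t of the coordinates
    other than X_0 divided out. *)
Definition zoom (u : tuples) (t : K) : tuples :=
  [tuple rescale (i != ord0) t (tnth u i) | i < n.+1].

Lemma zoom_family d u : homogeneous d u -> homog_family d (zoom u).
Proof.
move=> hu; split=> [t i|i]; first by rewrite tnth_mktuple rescale_homog.
rewrite (_ : (fun t => _) = fun t => rescale (i != ord0) t (tnth u i)); first exact: rescale_continuous.
by apply/funext=> t; rewrite tnth_mktuple.
Qed.

Lemma homothety_unit t : t != 0 -> homothety t \in unitmx.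
Proof. by move=> t0; apply: diag_unit => i; rewrite mxE; case: ifP; rewrite ?oner_neq0. Qed.

Lemma homothety_mul s t : homothety s *m homothety t = homothety (s * t).
Proof.
rewrite mulmx_diag; congr diag_mx; apply/rowP => i; rewrite !mxE.
by case: ifP; rewrite ?mulr1.
Qed.

Lemma homothety1 : homothety 1 = 1%:M.
Proof.
apply/matrixP => i j; rewrite !mxE; case: (i == ord0); by rewrite ?mulr1n.
Qed.

Lemma zoom_eq d u t a : homogeneous d u -> (forall i, ev (tnth u i) origin = a * origin i 0) ->
  tcomp u (lin_tuple (homothety t)) = tcomp (lin_tuple (homothety t)) (zoom u t).
Proof.
move=> hu u0; apply: eq_from_tnth => i; rewrite !tnth_tcomp comp_homothety tnth_homothety.
rewrite comp_mpolyZ comp_X tnth_mktuple.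
have [_|i0] := eqVneq i ord0; first by rewrite scale1r.
rewrite (rescale_shift t (hu i)) // u0 /origin mxE (negPf i0) mulr0 //.
Qed.

Lemma zoom_represents d u t a f :
  homogeneous d u -> (forall i, ev (tnth u i) origin = a * origin i 0) ->
  represents f u -> t != 0 -> represents (f ^ lin (homothety t))%g (zoom u t).
Proof.
move=> hu u0 fu t0.
have -> : zoom u t = tcomp (lin_tuple (homothety t^-1)) (tcomp u (lin_tuple (homothety t))).
  rewrite (zoom_eq t hu u0) -tcompA lin_tuple_mul homothety_mul mulVf // homothety1 lin_tuple1.
  by apply: eq_from_tnth => i; rewrite !tnth_mktuple comp_mpolyXU -tnth_nth tnth_mktuple.
rewrite conjgE; apply: represents_mul; last first.
  by apply: represents_mul => //; apply/lin_represents/homothety_unit.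
have <- : lin (homothety t^-1) = (lin (homothety t))^-1%g.
  apply/esym/mulg1_eq; rewrite -lin_mul ?homothety_unit ?invr_eq0 //.
  by rewrite homothety_mul mulfV // homothety1 lin_1.
by apply: lin_represents; rewrite homothety_unit // invr_eq0.
Qed.

(** The matrix of the linear terms of u at the origin, for u of degree d + 1 that fixes
    the origin: the coefficients are those of X_0^d X_j. *)
Definition linpart d (u : tuples) : M := \matrix_(i, j)
  if i == ord0 then (if j == ord0 then ev (tnth u i) origin else 0)
  else (if j == ord0 then 0 else (tnth u i)@_(U_(ord0) *+ d + U_(j))%MM).

Lemma mcoeff_XnX (d : nat) (j : 'I_n.+1) m :
  ('X_ord0 ^+ d * 'X_j : P)@_m = (m == (U_(ord0) *+ d + U_(j))%MM)%:R.
Proof. by rewrite mpolyXn -mpolyXD mcoeffX eq_sym. Qed.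

(** At t = 0 only the terms of least weight survive: weight 0 in the coordinate X_0, and
    weight 1 in the others, which have no term of weight 0. *)
Lemma zoom0 d u a : homogeneous d.+1 u -> (forall i, ev (tnth u i) origin = a * origin i 0) ->
  forall i, tnth (zoom u 0) i = 'X_ord0 ^+ d * tnth (lin_tuple (linpart d u)) i.
Proof.
move=> hu u0 i; rewrite !tnth_mktuple mulr_sumr.
apply/mpolyP => m; rewrite rescale_coef raddf_sum /=.
under eq_bigr => j _ do rewrite -scalerAr mcoeffZ mcoeff_XnX mxE.
have inj j k : (U_(ord0) *+ d + U_(j) == U_(ord0) *+ d + U_(k) :> 'X_{1..n.+1})%MM = (j == k).
  apply/eqP/eqP => [/mnmP/(_ k)|->//]; rewrite !mnmDE => /addnI; rewrite !mnm1E eqxx.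
  by case: eqP.
have [i0|i0] := eqVneq i ord0.
  rewrite subn0 (bigD1 ord0) //= big1 ?addr0; last by move=> j j0; rewrite (negPf j0) mul0r.
  rewrite expr0n (ev_origin (hu i)).
  have -> : (U_(ord0) *+ d + U_(ord0) = U_(ord0) *+ d.+1 :> 'X_{1..n.+1})%MM.
    by apply/mnmP => k; rewrite mnmDE !mulmnE mulnSr.
  have [w0|w0] := eqVneq (weight m) 0%N; last first.
    by case: eqP => [E|_]; rewrite ?mulr0 //; move: w0; rewrite E weight_U0.
  case: eqP => [->//|Em]; rewrite !(mulr0, mulr1).
  apply: (dhomog_nemf_coeff (hu i)); apply/eqP => md; apply: Em.
  by rewrite (weight_eq0 w0) md.
have w0coef k : weight k = 0%N -> (tnth u i)@_k = 0.
  by move=> wk; apply: (coef_weight0 (hu i) wk); rewrite u0 /origin mxE (negPf i0) mulr0.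
have R0 : (forall j, j != ord0 -> m != (U_(ord0) *+ d + U_(j))%MM) ->
    \sum_j (if j == ord0 then 0 else (tnth u i)@_(U_(ord0) *+ d + U_(j))) *
      (m == (U_(ord0) *+ d + U_(j))%MM)%:R = 0.
  move=> H; apply: big1 => j _; have [_|j0] := eqVneq j ord0; first by rewrite mul0r.
  by rewrite (negPf (H j j0)) mulr0.
have wj j : j != ord0 -> weight (U_(ord0) *+ d + U_(j))%MM = 1%N.
  by move=> j0; rewrite weightD weight_U0 weight_U j0.
case w: (weight m) => [|[|k]].
- rewrite w0coef // mul0r R0 // => j j0; apply: contra_eq_neq w => ->.
  by rewrite wj.
- have [j j0 Em] := weight_eq1 w; rewrite subnn mulr1.
  have [md|md] := eqVneq (mdeg m) d.+1.
    rewrite md in Em; rewrite Em (bigD1 j) //= (negPf j0) eqxx mulr1 big1 ?addr0 // => l lj.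
    by rewrite inj (eq_sym j l) (negPf lj) mulr0.
  rewrite (dhomog_nemf_coeff (hu i) md) R0 // => l l0; apply: contraNneq md => ->.
  by rewrite mdegD mdegMn !mdeg1 mul1n addn1.
- rewrite subn1 expr0n mulr0 R0 // => j j0; apply: contra_eq_neq w => ->.
  by rewrite wj.
Qed.

Lemma sends_pos f y : sends f origin y -> exists d u a,
  [/\ represents f u, homogeneous d.+1 u, a != 0 & forall i, ev (tnth u i) origin = a * y i 0].
Proof.
move=> [u [a [fu a0 hu]]]; have [d du] := represents_homog fu.
exists d, [tuple 'X_ord0 * tnth u i | i < n.+1], a; split => //.
- exact: represents_raise.
- exact: raise_homog.
- by move=> i; rewrite tnth_mktuple /ev mevalM mevalXU /origin mxE eqxx mul1r; exact: hu.
Qed.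

(** The conjugates of f by the homotheties of ratio t converge to the linear part A of f
    at the origin.  The same holds for the inverse of f; that the two limits are inverse
    to each other passes from t <> 0 to t = 0 because proportionality is a closed
    condition, and the composite does not degenerate to 0 because its value at the origin
    does not depend on t.  In particular A is invertible. *)
Lemma zoom_limit f : local_iso f origin origin -> exists c : K -> bir K n,
  [/\ curve c, curve (fun t => (c t)^-1)%g,
    forall t, t != 0 -> c t = (f ^ lin (homothety t))%g &
    exists2 A : M, A \in unitmx & c 0 = lin A].
Proof.
move=> [/sends_pos[d [u [a [fu hu a0 ua]]]] /sends_pos[e [v [b [fv hv b0 vb]]]]].
have [hU cU] := zoom_family hu; have [hV cV] := zoom_family hv.
(* The value at the origin involves only terms of weight 0, which t does not affect. *)
have evb (w : tuples) k c i : homogeneous k w -> (forall i, ev (tnth w i) origin = c * origin i 0) ->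
    ev (tnth (zoom w 0) i) origin = c * origin i 0.
  by move=> hw wc; rewrite tnth_mktuple (ev_rescale _ _ (hw i)).
have nz (w1 w2 : tuples) k1 k2 c1 c2 : homogeneous k1 w1 -> homogeneous k2 w2 -> c1 != 0 -> c2 != 0 ->
    (forall i, ev (tnth w1 i) origin = c1 * origin i 0) ->
    (forall i, ev (tnth w2 i) origin = c2 * origin i 0) ->
    nonzero (tcomp (zoom w1 0) (zoom w2 0)).
  move=> h1 h2 c10 c20 e1 e2; exists ord0; rewrite tnth_mktuple.
  suff : ev (tnth (zoom w1 0) ord0 \mPo zoom w2 0) origin != 0.
    by apply: contraNneq => ->; rewrite /ev meval0.
  rewrite ev_comp.
  have -> : \col_i ev (tnth (zoom w2 0) i) origin = c2 *: origin.
    by apply/colP => i; rewrite mxE (evb w2 k2 c2) // [RHS]mxE.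
  rewrite (ev_homog _ _ ((zoom_family h1).1 0 ord0)) (evb w1 k1 c1) //.
  by rewrite /origin mxE !eqxx mulr1 mulf_neq0 // expf_neq0.
have pr g (w1 w2 : tuples) k1 k2 c1 c2 : homogeneous k1 w1 -> homogeneous k2 w2 ->
    represents g w1 -> represents g^-1%g w2 ->
    (forall i, ev (tnth w1 i) origin = c1 * origin i 0) ->
    (forall i, ev (tnth w2 i) origin = c2 * origin i 0) ->
    proportional (tcomp (zoom w1 0) (zoom w2 0)) (id_tuple K n).
  move=> h1 h2 g1 g2 e1 e2 i j.
  have [_ cW] := homog_family_comp (zoom_family h1) (zoom_family h2).
  apply/eqP; rewrite -subr_eq0; apply/eqP.
  pose F t := tnth (tcomp (zoom w1 t) (zoom w2 t)) i * tnth (id_tuple K n) j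
    + (-1)%:MP * (tnth (tcomp (zoom w1 t) (zoom w2 t)) j * tnth (id_tuple K n) i).
  suff : F 0 = 0 by rewrite /F mpolyCN mulN1r.
  apply: (continuous_family_vanish (p := F)).
    apply: continuous_familyD.
      by apply: continuous_familyM; [exact: cW | exact: continuous_family_cst].
    apply: continuous_familyM; first exact: continuous_family_cst.
    by apply: continuous_familyM; [exact: cW | exact: continuous_family_cst].
  move=> t t0; rewrite /F mpolyCN mulN1r; apply/eqP; rewrite subr_eq0; apply/eqP.
  have r1 := zoom_represents h1 e1 g1 t0; have r2 := zoom_represents h2 e2 g2 t0.
  apply: (proportional_of_represents (represents_mul r1 r2)); rewrite conjVg mulgV.
  exact: represents_one.
have fvi : represents (f^-1)^-1%g u by rewrite invgK.
have [f0 [f0u f0v]] := bir_intro (hU 0) (hV 0)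
  (nz _ _ _ _ _ _ hu hv a0 b0 ua vb) (nz _ _ _ _ _ _ hv hu b0 a0 vb ua)
  (pr _ _ _ _ _ _ _ hu hv fu fv ua vb) (pr _ _ _ _ _ _ _ hv hu fv fvi vb ua).
exists (fun t => if t == 0 then f0 else (f ^ lin (homothety t))%g); split.
- exists d.+1, (zoom u); split; first exact: zoom_family.
  move=> t; have [->//|t0] := eqVneq t 0; exact: (zoom_represents hu ua).
- exists e.+1, (zoom v); split; first exact: zoom_family.
  move=> t; have [->//|t0] := eqVneq t 0; rewrite -conjVg; exact: (zoom_represents hv vb).
- by move=> t /negPf ->.
- have E := zoom0 hu ua; rewrite eqxx.
  have R : represents f0 (lin_tuple (linpart d u)).
    apply: (represents_proportional f0u (lin_tuple_homog _)).
      have [i] := represents_nonzero f0u; rewrite E mulf_eq0 negb_or => /andP[_ ?]; by exists i.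
    by move=> i j; rewrite !E -!mulrA; congr (_ * _); rewrite mulrC.
  have uA := lin_tuple_unit R; exists (linpart d u) => //; exact: lin_eq.
Qed.
End Contraction.

(** * Points in general position *)

Section Points.
Variables (K : localFieldType) (n : nat).

Lemma large_uniq k : exists s : seq K, uniq s /\ size s = k.
Proof.
elim: k => [|k [s [us <-]]]; first by exists [::].
by have [x xs] := infinite_field s; exists (x :: s); rewrite /= xs.
Qed.

Lemma poly_vanish (q : {poly K}) : (forall t, q.[t] = 0) -> q = 0.
Proof.
move=> q0; apply/eqP; apply: contraT => nq; have [s [us ss]] := large_uniq (size q).
have := max_poly_roots nq (rs := s) _ us; rewrite ss ltnn; apply.
by apply/allP => x _; rewrite rootE q0.
Qed.

(** The variables are eliminated from the last to the first.  After j steps, the part of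
    p with prescribed exponents c in the last j variables vanishes as a function of the
    n - j others; one more variable is then treated as the variable of a polynomial. *)
Lemma mpoly_vanish (p : {mpoly K[n]}) : (forall v, p.@[v] = 0) -> p = 0.
Proof.
move=> p0.
pose agree k (c m : 'X_{1..n}) := [forall i : 'I_n, (k <= i)%N ==> (m i == c i)].
suff H j : (j <= n)%N -> forall (c : 'X_{1..n}) (v : 'I_n -> K),
    \sum_(m <- msupp p | agree (n - j)%N c m) p@_m * \prod_(i < n | (i < n - j)%N) v i ^+ m i = 0.
  apply/mpolyP => c; rewrite mcoeff0; have := H n (leqnn n) c (fun=> 0); rewrite subnn.
  have E m : agree 0%N c m = (m == c).
    apply/forallP/eqP => [A|-> i //]; last by rewrite eqxx implybT.
    by apply/mnmP => i; have := A i; rewrite /= => /eqP.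
  under eq_bigl => m do rewrite E.
  have [cp|cp] := boolP (c \in msupp p); last by rewrite (memN_msupp_eq0 cp).
  by rewrite -big_filter filter_pred1_uniq // big_seq1 big_pred0 ?mulr1.
elim: j => [_ c v|j ih jn c v].
  rewrite subn0 -[RHS](p0 v) mevalE; apply: eq_big => [m|m _].
    by apply/forallP => i; rewrite leqNgt ltn_ord.
  by congr (_ * _); apply: eq_bigl => i; rewrite ltn_ord.
set k := (n - j.+1)%N; have kn : (n - j)%N = k.+1 by rewrite /k -subSn.
have ltk : (k < n)%N by rewrite -kn leq_subr.
pose k' := Ordinal ltk.
pose q : {poly K} := \sum_(m <- msupp p | agree k.+1 c m)
   (p@_m * \prod_(i < n | (i < k)%N) v i ^+ m i) *: 'X^(m k').
have : q = 0.
  apply: poly_vanish => t; rewrite horner_sum.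
  rewrite -[RHS](ih (ltnW jn) c (fun i => if i == k' then t else v i)) kn.
  apply: eq_bigr => m _; rewrite hornerZ hornerXn -mulrA; congr (_ * _).
  rewrite [RHS](bigD1 k') //= eqxx mulrC; congr (_ * _).
  apply: eq_big => [i|i]; first by rewrite ltnS ltn_neqAle andbC.
  by case: eqP => // -> /=; rewrite ltnn.
move/(congr1 (fun r : {poly K} => r`_(c k'))); rewrite coef0 coef_sum; apply: etrans.
rewrite [LHS]big_mkcond [RHS]big_mkcond; apply: eq_bigr => m _.
rewrite coefZ coefXn.
have -> : agree k c m = agree k.+1 c m && (c k' == m k').
  apply/forallP/andP => [A|[/forallP A /eqP ck] i].
    split; last by have := A k'; rewrite leqnn eq_sym.
    by apply/forallP => i; apply/implyP => /ltnW ki; have := A i; rewrite ki.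
  rewrite leq_eqVlt; apply/implyP => /orP[/eqP ki|ki]; last by have := A i; rewrite ki.
  have -> : i = k' by apply: val_inj.
  by rewrite ck.
by case: (agree k.+1 c m) => //=; case: eqP; rewrite ?mulr1 ?mulr0.
Qed.

Lemma nonroot (p : {mpoly K[n]}) : p != 0 -> exists v, p.@[v] != 0.
Proof.
move=> /eqP np; apply/not_existsP => H; apply: np; apply: mpoly_vanish => v.
by apply/eqP; have /negP := H v; rewrite negbK.
Qed.
End Points.

Section GeneralPosition.
Variables (K : localFieldType) (n : nat).
Local Notation P := {mpoly K[n.+1]}.
Local Notation tuples := (n.+1.-tuple P).
Local Notation M := 'M[K]_n.+1.

(** Besides D, the point has to avoid the zeros of X_0, of a coordinate of u and of a
    coordinate of the composite of u with a representative of the inverse of f. *)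
Lemma general_position (f : bir K n) (u : tuples) (D : P) :
  represents f u -> D != 0 ->
  exists x : 'cV[K]_n.+1, let y := \col_i ev (tnth u i) x in
    [/\ ev D x != 0, x != 0, y != 0 & local_iso f x y].
Proof.
move=> fu D0; have [v fv] := represents_exists f^-1%g.
have [i ui] := represents_nonzero fu; have [j vj] := represents_nonzero (represents_mul fv fu).
have : D * 'X_ord0 * tnth u i * tnth (tcomp v u) j != 0 by rewrite !mulf_neq0 // X_neq0.
move=> /nonroot[w]; rewrite !mevalM !mulf_eq0 !negb_or => /andP[/andP[/andP[Dw w0] uw] vw].
pose x : 'cV[K]_n.+1 := \col_i w i; exists x.
have evw p : ev p x = p.@[w] by apply: meval_eq => k; rewrite mxE.
have x0 : x ord0 0 != 0 by rewrite mxE; rewrite mevalXU in w0.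
set y := \col_i _; split.
- by rewrite evw.
- by apply: contraNneq x0 => ->; rewrite mxE.
- apply: contraNneq uw => y0; have := congr1 (fun z : 'cV[K]_n.+1 => z i 0) y0.
  by rewrite !mxE evw => ->.
- split.
    by exists u, 1; split=> // [|k]; rewrite ?oner_neq0 // mul1r mxE.
  have pv k l : ev (tnth v k) y * x l 0 = ev (tnth v l) y * x k 0.
    have := represents_inv fu fv k l; move/(congr1 (fun p => ev p x)).
    rewrite !tnth_mktuple /ev !mevalM !mevalXU.
    by have := ev_comp (tnth v k) u x; have := ev_comp (tnth v l) u x; rewrite /ev => -> ->.
  exists v, (ev (tnth v ord0) y / x ord0 0); split=> // [|k]; last first.
    by rewrite mulrAC -pv mulfK.
  rewrite mulf_neq0 ?invr_eq0 //; apply: contraNneq vw => v0.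
  have := pv j ord0; rewrite v0 mul0r => /eqP; rewrite mulf_eq0 (negPf x0) orbF.
  by rewrite tnth_mktuple -evw ev_comp.
Qed.

Lemma rank_two_rows (a b : 'rV[K]_n.+1) i j : a 0 i * b 0 j != a 0 j * b 0 i ->
  \rank (col_mx a b) = 2%N.
Proof.
move=> ab; apply/eqP; rewrite -[X in _ == X]/(1 + 1)%N -/(row_free _).
rewrite -kermx_eq0; apply/rowV0P => v /sub_kermxP.
rewrite -[v]hsubmxK; move: (lsubmx v) (rsubmx v) => v1 v2; rewrite mul_row_col.
move=> E; have {}E k : v1 0 0 * a 0 k + v2 0 0 * b 0 k = 0.
  by have /rowP/(_ k) := E; rewrite !mxE !big_ord1.
rewrite -subr_eq0 in ab.
have z1 : v1 0 0 = 0.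
  apply: (mulIf ab); rewrite mul0r.
  have -> : v1 0 0 * (a 0 i * b 0 j - a 0 j * b 0 i) =
    (v1 0 0 * a 0 i + v2 0 0 * b 0 i) * b 0 j - (v1 0 0 * a 0 j + v2 0 0 * b 0 j) * b 0 i by ring.
  by rewrite !E !mul0r subrr.
have z2 : v2 0 0 = 0.
  apply: (mulIf ab); rewrite mul0r.
  have -> : v2 0 0 * (a 0 i * b 0 j - a 0 j * b 0 i) =
    (v1 0 0 * a 0 j + v2 0 0 * b 0 j) * a 0 i - (v1 0 0 * a 0 i + v2 0 0 * b 0 i) * a 0 j by ring.
  by rewrite !E !mul0r subrr.
by rewrite [v1]mx11_scalar [v2]mx11_scalar z1 z2 !raddf0 row_mx0.
Qed.

Lemma exists_unitmx_cols (i1 : 'I_n.+1) (x y : 'cV[K]_n.+1) i j :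
  i1 != ord0 -> x i 0 * y j 0 != x j 0 * y i 0 ->
  exists A : M, [/\ A \in unitmx, A *m delta_mx ord0 0 = x & A *m delta_mx i1 0 = y].
Proof.
move=> i10 xy.
pose U : 'M[K]_(1 + 1, n.+1) := col_mx (delta_mx 0 ord0) (delta_mx 0 i1).
pose f : M := \matrix_(k, l) if k == ord0 then x l 0 else y l 0.
have Uf : U *m f = col_mx x^T y^T.
  rewrite mul_col_mx -!rowE; congr col_mx; apply/rowP => l; rewrite !mxE ?eqxx //.
  by rewrite (negPf i10).
have rU : \rank U = 2%N.
  apply: (rank_two_rows (i := ord0) (j := i1)); rewrite !mxE !eqxx (negPf i10).
  rewrite (eq_sym _ i1) (negPf i10).
  by rewrite mulr1 mulr0 oner_neq0.
have [|g ug Ug] := @complete_unitmx _ _ _ U f.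
  by rewrite Uf rU; apply: (rank_two_rows (i := i) (j := j)); rewrite !mxE.
move: Ug; rewrite Uf mul_col_mx -!rowE => /eq_col_mx[g0 g1].
exists g^T; split; first by rewrite unitmx_tr.
  by rewrite -colE -tr_row -g0 trmxK.
by rewrite -colE -tr_row -g1 trmxK.
Qed.

Lemma exists_unitmx_col (i1 : 'I_n.+1) (x : 'cV[K]_n.+1) : i1 != ord0 -> x != 0 ->
  exists2 A : M, A \in unitmx & A *m delta_mx ord0 0 = x.
Proof.
move=> i10 x0; have [i xi] : exists i, x i 0 != 0.
  apply/existsP; apply: contraNT x0; rewrite negb_exists => /forallP H.
  by apply/eqP/colP => i; have := H i; rewrite negbK mxE => /eqP.
pose j := if i == ord0 then i1 else ord0.
have ji : (i == j) = false.
  by rewrite /j; have [->|/negPf->//] := eqVneq i ord0; rewrite eq_sym (negPf i10).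
have [|A [uA Ax _]] := @exists_unitmx_cols i1 x (delta_mx j 0) i j i10; last by exists A.
by rewrite !mxE !eqxx ji mulr1 mulr0.
Qed.
End GeneralPosition.

(** * Transvections, dilations and twists *)

Section Elementary.
Variables (K : fieldType) (n : nat).
Local Notation P := {mpoly K[n.+1]}.
Local Notation tuples := (n.+1.-tuple P).
Local Notation M := 'M[K]_n.+1.
Implicit Types (k l : 'I_n.+1) (u v : tuples).

Definition transvection k l (t : K) : M := 1%:M + t *: delta_mx k l.
Definition dilation k (a : K) : M := diag_mx (\row_i if i == k then a else 1).

Lemma lin_tuple_transvection k l t i :
  tnth (lin_tuple (transvection k l t)) i = 'X_i + (if i == k then t else 0) *: 'X_l.
Proof.
rewrite tnth_mktuple; under eq_bigr => j _ do rewrite !mxE scalerDl.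
rewrite big_split /=; congr (_ + _).
  rewrite (bigD1 i) //= eqxx scale1r big1 ?addr0 // => j ji.
  by rewrite eq_sym (negPf ji) scale0r.
rewrite (bigD1 l) //= eqxx andbT big1 ?addr0 => [|j jl]; last first.
  by rewrite (negPf jl) andbF mulr0 scale0r.
by case: eqP; rewrite ?mulr1 ?mulr0.
Qed.

Lemma lin_tuple_dilation k a i :
  tnth (lin_tuple (dilation k a)) i = (if i == k then a else 1) *: 'X_i.
Proof. by rewrite lin_tuple_diag mxE. Qed.

Lemma comp_transvection k l t u i :
  tnth (lin_tuple (transvection k l t)) i \mPo u = tnth u i + (if i == k then t else 0) *: tnth u l.
Proof. by rewrite lin_tuple_transvection raddfD /= comp_mpolyZ !comp_mpolyXU -!tnth_nth. Qed.

Lemma transvection_unit k l t : k != l -> transvection k l t \in unitmx.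
Proof.
move=> kl; apply: (proj1 (@mulmx1_unit _ _ _ (transvection k l (- t)) _)).
rewrite /transvection mulmxDl mul1mx mulmxDr mulmx1 -scalemxAl -scalemxAr.
rewrite mul_delta_mx_cond eq_sym (negPf kl).
by rewrite mulr0n !scaler0 addr0 scaleNr addrNK.
Qed.

Lemma dilation_unit k a : a != 0 -> dilation k a \in unitmx.
Proof. by move=> a0; apply: diag_unit => i; rewrite mxE; case: ifP; rewrite ?oner_neq0. Qed.

Variables (i1 i2 : 'I_n.+1).
Hypotheses (i10 : i1 != ord0) (i20 : i2 != ord0) (i12 : i1 != i2).

(** The pair (a, b) stands for the linear form a X_0 + b X_i2.  In the affine coordinates
    x = X_i2 / X_0, y = X_i1 / X_0, the twist by the forms a and b multiplies y by the
    function a / b of x and fixes the other coordinates. *)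
Definition lform (a : K * K) : P := a.1 *: 'X_ord0 + a.2 *: 'X_i2.
Definition twist (a b : K * K) : tuples :=
  [tuple (if i == i1 then lform a else lform b) * 'X_i | i < n.+1].

Lemma tnth_twist a b i :
  tnth (twist a b) i = (if i == i1 then lform a else lform b) * 'X_i.
Proof. by rewrite tnth_mktuple. Qed.

Lemma lform_homog a : lform a \is 1.-homog.
Proof. by apply: rpredD; apply: dhomogZ; rewrite dhomogX; apply/eqP/mdeg1. Qed.

Lemma twist_homog a b : homogeneous 2 (twist a b).
Proof.
move=> i; rewrite tnth_mktuple; apply: (@dhomogM _ _ _ 1 _ 1).
  by case: ifP => _; exact: lform_homog.
by rewrite dhomogX; apply/eqP/mdeg1.
Qed.

Lemma comp_lform a u : lform a \mPo u = a.1 *: tnth u ord0 + a.2 *: tnth u i2.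
Proof. by rewrite raddfD /= !comp_mpolyZ !comp_mpolyXU -!tnth_nth. Qed.

Lemma comp_lform_twist a b c : lform a \mPo twist b c = lform c * lform a.
Proof.
rewrite comp_lform !tnth_mktuple eq_sym (negPf i10) eq_sym (negPf i12).
by rewrite !scalerAr -mulrDr.
Qed.

Lemma comp_twist a b c d i : tnth (twist a b) i \mPo twist c d =
  lform d * (if i == i1 then lform a * lform c else lform b * lform d) * 'X_i.
Proof.
rewrite tnth_mktuple rmorphM /= comp_X tnth_mktuple.
case: ifP => _; rewrite comp_lform_twist; ring.
Qed.

Lemma lform_neq0 a : a != (0, 0) -> lform a != 0.
Proof.
apply: contraNneq => E; have c0 : (lform a)@_U_(ord0) = 0 by rewrite E mcoeff0.
have c2 : (lform a)@_U_(i2) = 0 by rewrite E mcoeff0.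
move: c0 c2; rewrite !mcoeffD !mcoeffZ !mcoeffXU !eqxx (negPf i20) eq_sym (negPf i20).
rewrite !mulr1 !mulr0 addr0 add0r; by case: (a) => /= ? ? -> ->.
Qed.

Lemma twist_bir a b : a != (0, 0) -> b != (0, 0) ->
  exists f : bir K n, represents f (twist a b).
Proof.
move=> a0 b0.
have E c d i : tnth (tcomp (twist c d) (twist d c)) i = lform c * (lform c * lform d) * 'X_i.
  by rewrite tnth_mktuple comp_twist; case: ifP => _; ring.
have nz c d : c != (0, 0) -> d != (0, 0) -> nonzero (tcomp (twist c d) (twist d c)).
  by move=> c0 d0; exists ord0; rewrite E !mulf_neq0 ?lform_neq0 ?X_neq0.
have pr c d : proportional (tcomp (twist c d) (twist d c)) (id_tuple K n).
  by move=> i j; rewrite !E !tnth_mktuple; ring.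
by have [f [fab _]] := bir_intro (twist_homog a b) (twist_homog b a) (nz a b a0 b0)
  (nz b a b0 a0) (pr a b) (pr b a); exists f.
Qed.
End Elementary.

Lemma conjg_involution (G : groupType) (s b g h : G) :
  (s * s = 1 -> b ^ s * g = g * b ^ s ->
  s * ((s * h) ^ b * g ^ b * ((s * h) ^ b)^-1) * s * g^-1 = (h * g * h^-1 * g^-1) ^ (b ^ s))%g.
Proof.
move=> ss ag; have sV : s^-1%g = s by apply: mulg1_eq.
have ga : (g^-1 ^ (b ^ s) = g^-1)%g by rewrite conjVg [in LHS]conjgE -ag mulKg.
rewrite [RHS]conjMg ga; congr (_ * _)%g.
rewrite -conjVg -!conjMg invgM sV.
have -> : (s * h * g * (h^-1 * s) = (h * g * h^-1) ^ s)%g by rewrite conjgE sV !mulgA.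
have H x : (s * x * s = x ^ s)%g by rewrite conjgE sV mulgA.
by rewrite H -!conjgM; congr (_ ^ _)%g; rewrite conjgE sV mulgA.
Qed.

(** * A closed normal subgroup that contains a nontrivial element *)

Section NormalClosed.
Variables (K : localFieldType) (n : nat).
Local Notation P := {mpoly K[n.+1]}.
Local Notation tuples := (n.+1.-tuple P).
Local Notation M := 'M[K]_n.+1.
Variables (i1 i2 : 'I_n.+1).
Hypotheses (i10 : i1 != ord0) (i20 : i2 != ord0) (i12 : i1 != i2).
Variable N : set (bir K n).
Hypotheses (nN : normal_subgroup N) (clN : closed N).

Variable f : bir K n.
Hypotheses (Nf : N f) (f1 : f <> 1%g).

Let N1 : N 1%g. Proof. by case: nN. Qed.
Let NM x y : N x -> N y -> N (x * y)%g. Proof. by case: nN => _ H _ _; exact: H. Qed.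
Let NV x : N x -> N x^-1%g. Proof. by case: nN => _ _ H _; exact: H. Qed.
Let NJ x y : N x -> N (x ^ y)%g. Proof. by case: nN => _ _ _ H; exact: H. Qed.
Let NVE x : N x^-1%g -> N x. Proof. by move=> /NV; rewrite invgK. Qed.
Let NMr x y : N x -> N (x * y)%g -> N y.
Proof. by move=> Nx Nxy; rewrite -[y](mulKg x); apply: NM => //; exact: NV. Qed.

Lemma commutator_meml x y z : (x * y = y * x * z)%g -> N x -> N z.
Proof.
move=> E Nx; have -> : z = (x^-1 * x ^ y)%g.
  by rewrite conjgE E -!mulgA !mulKg.
by apply: NM; [exact: NV | exact: NJ].
Qed.

Lemma commutator_memr x y z : (x * y = y * x * z)%g -> N y -> N z.
Proof.
move=> E Ny; have -> : z = ((y^-1) ^ x * y)%g.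
  by rewrite conjgE -!mulgA E -!mulgA !mulKg.
by apply: NM => //; apply/NJ/NV.
Qed.

(** After a linear change of coordinates f is replaced by h with h p0 = p1, for two
    coordinate points p0 and p1.  The transvection g fixes both, and is tangent to the
    identity at p0 but not at p1.  Conjugated by homotheties centred at p1, the element
    h g h^-1 g^-1 of N tends to g^-1: the factor h g h^-1 tends to 1, and g commutes with
    the homotheties. *)
Lemma transvection_mem : N (lin (transvection ord0 i2 1)).
Proof.
set g := lin _.
have o2 : ord0 != i2 by rewrite eq_sym.
have ug (t : K) : transvection ord0 i2 t \in unitmx by exact: transvection_unit.
have [u fu] := represents_exists f.
have [i [j D0]] : exists i j, tnth u i * 'X_j - tnth u j * 'X_i != 0.
  apply/not_existsP => H; apply: f1; apply: (represents_inj fu (@represents_one K n)) => i j.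
  rewrite !tnth_mktuple; apply/eqP; rewrite -subr_eq0.
  by apply: contraT => Dij; case: (H i); exists j.
have [x [Dx _ _ regf]] := general_position fu D0; move: regf; set y := \col_k _ => regf.
have [|A [uA Ax Ay]] := @exists_unitmx_cols _ _ i1 x y i j i10.
  rewrite !mxE; apply: contraNneq Dx => E.
  rewrite /ev mevalB !mevalM !mevalXU -/(ev (tnth u i) x) -/(ev (tnth u j) x).
  by rewrite (mulrC _ (x j 0)) -E mulrC subrr.
pose p0 : 'cV[K]_n.+1 := delta_mx ord0 0; pose p1 : 'cV[K]_n.+1 := delta_mx i1 0.
pose h := (f ^ lin A)%g.
have Nh : N h by exact: NJ.
have regh : local_iso h p0 p1.
  rewrite /h conjgE -lin_inv //; apply: (local_iso_mul (y := y)); last first.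
    by apply: local_iso_lin; rewrite ?unitmx_inv // -Ay mulKmx.
  by apply: (local_iso_mul (y := x)) => //; exact: local_iso_lin.
(* The zoom is at p0: the involution s moves p1 to p0, so that s h fixes p0. *)
pose S : M := tperm_mx ord0 i1; have uS : S \in unitmx by exact: unitmx_perm.
have SS : S *m S = 1%:M by rewrite /S /tperm_mx -perm_mxM tperm2 perm_mx1.
pose s := lin S.
have ss : (s * s = 1)%g by rewrite -lin_mul // SS lin_1.
have Sp : S *m p1 = p0.
  rewrite /S -[tperm_mx _ _]/(perm_mx _) -row_permE; apply/matrixP => k l; rewrite !mxE.
  congr (_ && _)%:R; case: tpermP => [->|->|/eqP/negPf k0 /eqP/negPf k1].
  - by rewrite !eqxx.
  - by rewrite (negPf i10) eq_sym (negPf i10).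
  - by rewrite k0 k1.
have [c [cc ccV cE [B uB c0]]] : exists c : K -> bir K n,
  [/\ curve c, curve (fun t => (c t)^-1)%g,
    forall t, t != 0 -> c t = ((s * h) ^ lin (homothety n t))%g &
    exists2 A : M, A \in unitmx & c 0 = lin A].
  by apply: zoom_limit; apply: local_iso_mul regh _; exact: local_iso_lin.
(* The conjugate of g by the homothety of ratio t is the transvection with entry t, which
   makes sense at t = 0. *)
pose k t := (s * (c t * lin (transvection ord0 i2 t) * (c t)^-1) * s * g^-1)%g.
have k0 : k 0 = g^-1%g.
  have -> : k 0 = (s * (c 0 * 1 * (c 0)^-1) * s * g^-1)%g.
    by rewrite /k (_ : transvection ord0 i2 0 = 1%:M) ?lin_1 // /transvection scale0r addr0.
  by rewrite mulg1 mulgV mulg1 ss mul1g.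
apply: NVE; rewrite -k0; apply: (curve_closed clN).
  apply: curveM; last exact: curve_cst.
  apply: curveM; last exact: curve_cst.
  apply: curveM; first exact: curve_cst.
  apply: curveM => //; apply: curveM => //.
  apply: curve_lin => // a b; rewrite (_ : (fun t => _) =
    fun t => (1%:M : M) a b + t * (delta_mx ord0 i2 : M) a b); last first.
    by apply/funext => t; rewrite [LHS]mxE [X in _ + X]mxE.
  apply: continuousD; first exact: cst_continuous.
  by apply: continuousM; [move=> ?; exact: cvg_id | exact: cst_continuous].
move=> t t0; have ub := homothety_unit n t0.
pose b := lin (homothety n t); pose a := (b ^ s)%g.
have gb : (b * lin (transvection ord0 i2 t) = g * b)%g.
  rewrite -!lin_mul //; congr lin; rewrite /transvection mulmxDr mulmxDl mulmx1 mul1mx; congr (_ + _).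
  apply/matrixP => p q; rewrite mul_diag_mx mul_mx_diag !mxE.
  by have [_|_] := eqVneq p ord0; have [->|_] := eqVneq q i2;
    rewrite /= ?(negPf i20) ?mulr1 ?mul1r ?mulr0 ?mul0r.
have ag : (a * g = g * a)%g.
  have sV : s^-1%g = s by apply: mulg1_eq.
  pose d : M := diag_mx (\row_q if q == i1 then 1 else t).
  have Ed : homothety n t *m S = S *m d.
    apply/matrixP => p q; rewrite mul_diag_mx mul_mx_diag !mxE mulrC.
    have [Epq|] := eqVneq (tperm ord0 i1 p) q; last by rewrite !mul0r.
    congr (_ * _); rewrite -Epq; case: tpermP => [->|->|/eqP/negPf -> /eqP/negPf -> //].
      by rewrite !eqxx.
    by rewrite (negPf i10) eq_sym (negPf i10).
  have -> : a = lin d.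
    by rewrite /a conjgE sV -!lin_mul ?unitmx_mul ?uS ?ub // Ed mulmxA SS mul1mx.
  have ud : d \in unitmx by apply: diag_unit => q; rewrite mxE; case: ifP; rewrite ?oner_neq0.
  rewrite -!lin_mul //; congr lin; rewrite /transvection mulmxDr mulmxDl mulmx1 mul1mx; congr (_ + _).
  apply/matrixP => p q; rewrite mul_diag_mx mul_mx_diag !mxE.
  have [->|_] := eqVneq p ord0; have [->|_] := eqVneq q i2; rewrite /= ?mulr0 ?mul0r //.
  by rewrite (eq_sym ord0) (negPf i10) (eq_sym i2) (negPf i12) mulrC.
have -> : k t = ((h * g * h^-1 * g^-1) ^ a)%g.
  rewrite /k cE // -/b; have -> : lin (transvection ord0 i2 t) = (g ^ b)%g by rewrite conjgE -gb mulKg.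
  exact: conjg_involution.
apply: NJ; have -> : (h * g * h^-1 * g^-1 = h * (h^-1 ^ g^-1))%g.
  by rewrite conjgE invgK !mulgA.
by apply: NM => //; apply/NJ/NV.
Qed.

(** In the coordinates x and y of the twists, the commutator of g with the map q that
    sends (x, y) to (x, x y) is the map h that sends (x, y) to (x, y / (1 + x)).  The affine
    map m that sends x to a x + (a - 1) multiplies 1 + x by a, so that its commutator with
    h multiplies y by a constant. *)
Lemma dilation_mem a : a != 0 -> N (lin (dilation i1 a)).
Proof.
pose g : bir K n := lin (transvection ord0 i2 1); have Ng : N g := transvection_mem.
have o2 : ord0 != i2 by rewrite eq_sym.
have i21 : (i2 == i1) = false by rewrite eq_sym (negPf i12).
have o1 : (ord0 == i1) = false by rewrite eq_sym (negPf i10).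
have n01 : (0, 1) != (0, 0) :> K * K by rewrite xpair_eqE oner_eq0 andbF.
have n10 : (1, 0) != (0, 0) :> K * K by rewrite xpair_eqE oner_eq0.
have n11 : (1, 1) != (0, 0) :> K * K by rewrite xpair_eqE oner_eq0.
have [q rq] := twist_bir i10 i20 i12 n01 n10.
have [h rh] := twist_bir i10 i20 i12 n10 n11.
have rg : represents g (lin_tuple (transvection ord0 i2 1)) by apply/lin_represents/transvection_unit.
have X0 := X_neq0 K (ord0 : 'I_n.+1); have X2 := X_neq0 K i2.
have Nh : N h.
  apply: (commutator_memr (x := q) (y := g)) => //.
  apply: represents_inj (represents_mul rq rg) (represents_mul (represents_mul rg rq) rh) _.
  apply: (@proportional_of_scaled _ _ _ _ ('X_ord0 * ('X_ord0 + 'X_i2)) 1).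
    rewrite !mulf_neq0 //; have := lform_neq0 i20 n11; by rewrite /lform /= !scale1r.
  move=> i; rewrite !tnth_tcomp tnth_twist rmorphM /= comp_X comp_transvection raddfD /= comp_mpolyZ.
  rewrite !(comp_twist i10 i12) i21 lin_tuple_transvection.
  rewrite [in LHS](fun_if (comp_mpoly _)) !comp_lform !lin_tuple_transvection /lform /=.
  rewrite !scale0r !scale1r ?eqxx (negPf i20).
  rewrite ?scale0r ?addr0 ?add0r ?scale1r.
  have [->|ii1] := eqVneq i i1; first by rewrite (negPf i10) !scale0r; ring.
  by case: (i == ord0); rewrite ?scale1r ?scale0r; ring.
suff {a} H a : a != 0 -> N (lin (dilation i1 a^-1)).
  by move=> a0; rewrite -[a]invrK; apply: H; rewrite invr_eq0.
move=> a0; pose m := (lin (transvection i2 ord0 (a - 1)) * lin (dilation i2 a))%g.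
have rm : represents m (tcomp (lin_tuple (transvection i2 ord0 (a - 1))) (lin_tuple (dilation i2 a))).
  by apply: represents_mul; apply: lin_represents; [exact: transvection_unit | exact: dilation_unit].
apply: (commutator_meml (x := h) (y := m)) => //.
have rd : represents (lin (dilation i1 a^-1)) (lin_tuple (dilation i1 a^-1)).
  by apply/lin_represents/dilation_unit; rewrite invr_eq0.
apply: represents_inj (represents_mul rh rm) (represents_mul (represents_mul rm rh) rd) _.
apply: (@proportional_of_scaled _ _ _ _ 1 a%:MP); first exact: oner_neq0.
have aK (p : P) : a%:MP * (a^-1 *: p) = p by rewrite mul_mpolyC scalerA mulfV // scale1r.
move=> i; rewrite !tnth_tcomp tnth_twist rmorphM /= comp_X tnth_tcomp.
have z2 : (ord0 == i2) = false by rewrite eq_sym (negPf i20).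
rewrite comp_transvection !lin_tuple_dilation z2 scale1r !raddfD /= !comp_mpolyZ !comp_X.
rewrite !tnth_twist o1 !rmorphM /= !comp_X.
rewrite !(fun_if (comp_mpoly _)) !comp_lform !tnth_tcomp !comp_transvection.
rewrite !lin_tuple_dilation z2 o1 i21 eqxx /=.
rewrite !scale1r !scale0r !addr0.
have -> : 'X_ord0 + (a *: 'X_i2 + (a - 1) *: 'X_ord0) = a%:MP * ('X_ord0 + 'X_i2) :> P.
  by rewrite -!mul_mpolyC mpolyCB mpolyC1; ring.
have [->|ii1] := eqVneq i i1.
  rewrite (negPf i12) !scale0r !scale1r !addr0 -[X in _ = a%:MP * X]scalerAr aK.
  ring.
case: (i == i2); rewrite ?scale1r ?scale0r; last by ring.
rewrite -!mul_mpolyC; ring.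
Qed.

Definition mx_mem (A : M) := A \in unitmx /\ N (lin A).

Lemma mx_mem_mul A B : mx_mem A -> mx_mem B -> mx_mem (A *m B).
Proof. by move=> [uA NA] [uB NB]; split; rewrite ?unitmx_mul ?uA // lin_mul //; exact: NM. Qed.

Lemma mx_mem_conj A B C : mx_mem A -> B \in unitmx -> B *m C = A *m B -> mx_mem C.
Proof.
move=> [uA NA] uB E; have -> : C = invmx B *m (A *m B) by rewrite -E mulKmx.
split; first by rewrite !unitmx_mul unitmx_inv uB uA.
by rewrite !lin_mul ?unitmx_mul ?unitmx_inv ?uA // lin_inv //; exact: NJ.
Qed.

Lemma mx_mem_cancel A B : mx_mem A -> mx_mem (A *m B) -> mx_mem B.
Proof.
move=> [uA NA] [uAB NAB]; have uB : B \in unitmx by move: uAB; rewrite unitmx_mul uA.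
by split=> //; move: NAB; rewrite lin_mul //; exact: NMr.
Qed.

Lemma mx_mem1 : mx_mem 1%:M.
Proof. by split; rewrite ?unitmx1 // lin_1. Qed.

Lemma mx_mem_dilation k a : a != 0 -> mx_mem (dilation k a).
Proof.
move=> a0; apply: (@mx_mem_conj (dilation i1 a) (tperm_mx i1 k)).
- by split; [exact: dilation_unit | exact: dilation_mem].
- exact: unitmx_perm.
apply/matrixP => x y; rewrite /dilation -[tperm_mx _ _]/(perm_mx _) -row_permE mul_diag_mx !mxE.
rewrite -mulr_natr; congr (_ * _).
by case: tpermP => [->|->|/eqP/negPf -> /eqP/negPf ->]; rewrite ?eqxx // eq_sym.
Qed.

Lemma mx_mem_diag (d : 'rV[K]_n.+1) : (forall i, d 0 i != 0) -> mx_mem (diag_mx d).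
Proof.
move=> d0; pose D (s : seq 'I_n.+1) : M := diag_mx (\row_i if i \in s then d 0 i else 1).
have H s : mx_mem (D s).
  elim: s => [|k s ih].
    rewrite /D (_ : \row__ _ = const_mx 1) ?diag_const_mx; first exact: mx_mem1.
    by apply/rowP => i; rewrite !mxE.
  have [ks|ks] := boolP (k \in s).
    rewrite /D (_ : \row__ _ = \row_i if i \in s then d 0 i else 1) //.
    by apply/rowP => i; rewrite !mxE inE; case: eqP => // ->; rewrite ks.
  rewrite (_ : D _ = dilation k (d 0 k) *m D s).
    by apply: mx_mem_mul => //; exact: mx_mem_dilation.
  rewrite mulmx_diag; congr diag_mx; apply/rowP => i; rewrite !mxE inE.
  by case: eqP => [->|_]; rewrite ?(negPf ks) ?mulr1 ?mul1r.
rewrite (_ : diag_mx d = D (enum 'I_n.+1)) //; congr diag_mx.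
by apply/rowP => i; rewrite mxE mem_enum.
Qed.

(** Conjugation by diag (t^(w i)), which lies in N, multiplies the entry (i, j) by
    t^(w i - w j).  If A is block triangular for the weight w, it has a limit as t tends
    to 0, the block diagonal part of A.  The quotient of the conjugate by A lies in N for
    t <> 0, hence also at the limit. *)
Lemma mx_mem_weight (w : 'I_n.+1 -> nat) (A : M) : A \in unitmx ->
  (forall i j, A i j != 0 -> (w j <= w i)%N) ->
  mx_mem (\matrix_(i, j) if w i == w j then A i j else 0) -> mx_mem A.
Proof.
move=> uA wA [uA0 NA0]; split=> //.
pose C t : M := \matrix_(i, j) (A i j * t ^+ (w i - w j)).
pose D t : M := diag_mx (\row_i t ^+ w i).
have ND t : t != 0 -> mx_mem (D t) by move=> t0; apply: mx_mem_diag => i; rewrite mxE expf_neq0.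
have E t : C t *m D t = D t *m A.
  apply/matrixP => i j; rewrite mul_diag_mx mul_mx_diag !mxE -mulrA -exprD [RHS]mulrC.
  by have [->|/wA/subnK ->//] := eqVneq (A i j) 0; rewrite !mul0r.
have C0 : C 0 = \matrix_(i, j) if w i == w j then A i j else 0.
  apply/matrixP => i j; rewrite !mxE; case: eqP => [->|/eqP wij]; first by rewrite subnn mulr1.
  have [->|/wA wji] := eqVneq (A i j) 0; first by rewrite mul0r.
  by rewrite expr0n subn_eq0 leqNgt ltn_neqAle eq_sym wij wji mulr0.
have uC t : C t \in unitmx.
  have [->|t0] := eqVneq t 0; first by rewrite C0.
  have := ND t t0 => -[uD _]; have : C t *m D t \in unitmx by rewrite E unitmx_mul uD.
  by rewrite unitmx_mul => /andP[].
suff : N (lin (C 0) * (lin A)^-1)%g by rewrite C0 => /(NMr NA0) /NVE.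
apply: (curve_closed clN (c := fun t => (lin (C t) * (lin A)^-1)%g)).
  apply: curveM; last exact: curve_cst.
  apply: curve_lin => // i j; rewrite (_ : (fun t => _) = fun t => A i j * t ^+ (w i - w j)).
    by apply: continuousM; [exact: cst_continuous | exact: continuousX].
  by apply/funext => t; rewrite mxE.
move=> t t0; have [uD NDt] := ND t t0; have := congr1 (@lin K n) (E t).
rewrite !lin_mul // => El; have -> : lin (C t) = (lin (D t) * lin A * (lin (D t))^-1)%g.
  by rewrite -El mulgK.
have -> : (lin (D t) * lin A * (lin (D t))^-1 * (lin A)^-1 =
  lin (D t) * ((lin (D t))^-1 ^ (lin A)^-1))%g by rewrite conjgE invgK !mulgA.
by apply: NM => //; apply/NJ/NV.
Qed.

(** The exchange of e_i and e_j is triangular in a basis that contains the fixed vector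
    e_i + e_j and e_j. *)
Lemma mx_mem_tperm i j : mx_mem (tperm_mx i j).
Proof.
have [<-|ij] := eqVneq i j; first by rewrite /tperm_mx tperm1 perm_mx1; exact: mx_mem1.
have ji : (j == i) = false by rewrite eq_sym (negPf ij).
pose T : M := dilation j (-1) + delta_mx i j.
have m1 : (-1 : K) != 0 by rewrite oppr_eq0 oner_neq0.
pose u := transvection j i (1 : K); have uu : u \in unitmx by apply: transvection_unit; rewrite ji.
have E : tperm_mx i j *m u = u *m T.
  have Eu : u = 1%:M + delta_mx j i by rewrite /u /transvection scale1r.
  rewrite -[tperm_mx _ _]/(perm_mx _) -row_permE Eu mulmxDl mul1mx.
  rewrite /T mulmxDr mul_delta_mx /dilation mul_mx_diag.
  apply/matrixP => k l; rewrite !mxE.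
  case: tpermP => [->|->|/eqP/negPf ki /eqP/negPf kj].
  - rewrite !eqxx (negPf ij) /= !(eq_sym _ l).
    have [->|li] := eqVneq l i; rewrite ?(negPf ij) ?mulr1n ?mulr0n /=; ring.
  - rewrite !eqxx ji /= !(eq_sym _ l).
    have [->|li] := eqVneq l i; first by rewrite (negPf ij) !mulr0n /=; ring.
    by rewrite andbF; case: (l == j); rewrite ?mulr1n ?mulr0n /=; ring.
  - by rewrite ki kj /= mul0r !addr0.
have uT : T \in unitmx.
  have : u *m T \in unitmx by rewrite -E unitmx_mul uu unitmx_perm.
  by rewrite unitmx_mul => /andP[].
suff NT : mx_mem T.
  apply: (mx_mem_conj (B := invmx u) NT); rewrite ?unitmx_inv //.
  by rewrite -[T in RHS](mulKmx uu) -E -!mulmxA mulmxV // mulmx1.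
apply: (@mx_mem_weight (fun k => k == i)) => //.
  move=> k l; rewrite !mxE; have [->|//] := eqVneq l i.
  by have [|ki] := eqVneq k i; rewrite // mulr0n add0r eqxx.
rewrite (_ : \matrix_(_, _) _ = dilation j (-1)); first exact: mx_mem_dilation.
apply/matrixP => k l; rewrite !mxE.
have [->|ki] := eqVneq k i; have [->|li] := eqVneq l i; rewrite /= ?(negPf ij) ?andbF ?addr0 //.
by rewrite (negPf ki).
Qed.

Lemma lin_mem A : A \in unitmx -> N (lin A).
Proof.
move=> uA; suff [] : mx_mem A by [].
have := cormen_lup_correct A; have := cormen_lup_perm A.
have := @cormen_lup_lower _ _ A; have := @cormen_lup_upper _ _ A.
case: (cormen_lup A) => [[Pm L] U] /= hU hL /is_perm_mxP[s ->] E.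
have {}E : perm_mx s *m A = L *m U by [].
have uLU : L *m U \in unitmx by rewrite -E unitmx_mul unitmx_perm.
have [uL uU] : L \in unitmx /\ U \in unitmx by move: uLU; rewrite unitmx_mul => /andP.
have NL : mx_mem L.
  apply: (@mx_mem_weight (fun i => i)) => // [i j|].
    by rewrite leqNgt; apply: contraNN => ij; rewrite hL ?(ltnW ij) // -val_eqE (ltn_eqF ij).
  rewrite (_ : \matrix_(_, _) _ = 1%:M); first exact: mx_mem1.
  apply/matrixP => i j; rewrite !mxE -val_eqE /=.
  by case: eqP => //= ij; rewrite hL ?ij // -val_eqE /= ij eqxx.
have NU : mx_mem U.
  apply: (@mx_mem_weight (fun i => n - i)%N) => // [i j|].
    move=> Uij; apply: leq_sub2l; rewrite leqNgt; apply: contraNN Uij => ij.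
    by rewrite hU.
  rewrite (_ : \matrix_(_, _) _ = diag_mx (\row_i U i i)).
    apply: mx_mem_diag => i; rewrite mxE; move: uU; rewrite -unitmx_tr unitmxE det_trig.
      by rewrite unitfE prodf_seq_neq0 => /allP/(_ i); rewrite mem_index_enum mxE; apply.
    by apply/is_trig_mxP => x y xy; rewrite mxE hU.
  apply/matrixP => i j; rewrite !mxE.
  have -> : (n - i == n - j)%N = (i == j).
    apply/eqP/eqP => [|-> //] e; apply: val_inj => /=.
    by rewrite -(subKn (n := n) (m := i)) ?e ?subKn // -ltnS.
  by case: eqP => [->|]; rewrite ?mulr1n ?mulr0n.
apply: (@mx_mem_cancel (perm_mx s)); last by rewrite E; exact: mx_mem_mul.
have [ts -> _] := prod_tpermP s.
elim: ts => [|[i j] ts ih]; first by rewrite big_nil perm_mx1; exact: mx_mem1.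
by rewrite big_cons perm_mxM; apply: mx_mem_mul => //; exact: mx_mem_tperm.
Qed.

(** Up to linear maps, which lie in N, the element e is a map h that fixes the origin.  As
    the homotheties b lie in N, so does the commutator of b and h, which tends to
    lin C * h^-1. *)
Lemma closed_normal_full : N = [set: bir K n].
Proof.
apply/seteqP; split => // e _.
have [u eu] := represents_exists e.
have [x [_ x0 y0 rege]] := general_position eu (oner_neq0 {mpoly K[n.+1]}).
set y := \col_k _ in y0 rege.
have [A uA Ax] := exists_unitmx_col i10 x0; have [B uB By] := exists_unitmx_col i10 y0.
pose h := ((lin B)^-1 * e * lin A)%g.
have regh : local_iso h (origin K n) (origin K n).
  rewrite /h -lin_inv //; apply: (local_iso_mul (y := x)); first exact: local_iso_lin.
  apply: (local_iso_mul (y := y)) => //.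
  by apply: local_iso_lin; rewrite ?unitmx_inv // -By mulKmx.
have [c [cc _ cE [C uC c0]]] := zoom_limit regh.
suff Nh : N h.
  have -> : e = (lin B * h * (lin A)^-1)%g by rewrite /h !mulgA mulgV mul1g mulgK.
  by apply: NM; [apply: NM => // | apply: NV]; exact: lin_mem.
apply: NVE; apply: (NMr (x := lin C)); first exact: lin_mem.
rewrite -c0; apply: (curve_closed clN (c := fun t => (c t * h^-1)%g)).
  by apply: curveM => //; exact: curve_cst.
move=> t t0; rewrite cE //; set b := lin _.
have Nb : N b by apply/lin_mem/homothety_unit.
have -> : (h ^ b * h^-1 = b^-1 * (b ^ h^-1))%g by rewrite !conjgE invgK !mulgA.
by apply: NM; [exact: NV | exact: NJ].
Qed.
End NormalClosed.

Theorem theorem2 (K : localFieldType) (n : nat) (hn : (2 <= n)%N)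
    (N : set (bir K n)) :
  normal_subgroup N -> closed N -> N = [set 1%g] \/ N = [set: bir K n].
Proof.
move=> nN clN; have [N1 _ _ _] := nN.
have [[f [Nf f1]]|H] := pselect (exists f, N f /\ f <> 1%g); last first.
  left; apply/seteqP; split => [g Ng|g -> //].
  by apply: contrapT => g1; apply: H; exists g.
right; have lt1 : (1 < n.+1)%N by rewrite ltnS ltnW.
by apply: (@closed_normal_full K n (Ordinal lt1) (Ordinal (hn : 2 < n.+1)%N)) Nf f1.
Qed.
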